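(* Let $K$ be an infinite field, $E=K\langle e_1,\dots,e_n\rangle$ the exterior algebra, and let $0\neq J\subsetneq E$ be a graded ideal with $\operatorname{depth} E/J=s$ such that $E/J$ has a linear injective resolution. Then there exists a polynomial $Q(t)\in\mathbb{Z}[t]$ with non-negative coefficients such that $$H(E/J,t)=Q(t)\cdot(1+t)^s\quad\text{and}\quad Q(-1)\neq 0.$$
   Context: $E$ is standard graded with $\deg e_i=1$. For a finitely generated graded $E$-module $M$ (with $am=(-1)^{\deg a\deg m}ma$ for homogeneous $a,m$), an element $v\in E_1$ is $M$-regular if $0:_Mv=vM$; a sequence $v_1,\dots,v_s\in E_1$ is $M$-regular if $v_i$ is $M/(v_1,\dots,v_{i-1})M$-regular for $i=1,\dots,s$ and $M/(v_1,\dots,v_s)M\neq 0$; all maximal $M$-regular sequences have the same length, called $\operatorname{depth}M$. $M$ has a linear injective resolution if for some $d\in\mathbb{Z}$ its minimal graded injective resolution has the form $0\to E(n-d)^{\mu_0}\to E(n-d+1)^{\mu_1}\to E(n-d+2)^{\mu_2}\to\cdots$ (equivalently, $\dim_K\operatorname{Ext}^i_E(K,M)_{j}=0$ unless $j=d-i$). The Hilbert series is $H(M,t)=\sum_i\dim_K M_i\,t^i$. *)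

(* Defs.v *)
From HB Require Import structures.
From mathcomp Require Import all_boot all_order all_algebra all_field.

Set Implicit Arguments.
Unset Strict Implicit.
Unset Printing Implicit Defensive.

Import Order.TTheory GRing.Theory Num.Theory.
Local Open Scope ring_scope.

Definition infinite_type (T : eqType) : Prop :=
  forall s : seq T, exists x, x \notin s.

(* An element is given by its coordinates in the monomial basis e_S, where    *)
(* e_S = e_(i_1) /\ ... /\ e_(i_k) for S = {i_1 < ... < i_k}.                 *)
Definition ext (K : fieldType) (n : nat) : Type := {ffun {set 'I_n} -> K^o}.

HB.instance Definition _ (K : fieldType) (n : nat) :=
  Vector.copy (ext K n) {ffun {set 'I_n} -> K^o}.

Section ExteriorAlgebra.
Variables (K : fieldType) (n : nat).
Implicit Types (A B C S : {set 'I_n}) (a b c : ext K n).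

Definition coef S a : K := (a : {ffun {set 'I_n} -> K^o}) S.

Definition mono S : ext K n := [ffun T => (T == S)%:R : K^o].

Definition evar (i : 'I_n) : ext K n := mono [set i].

(* The number of transpositions needed to sort the word e_A e_B. *)
Definition inversions A B : nat := (\sum_(x in A) \sum_(y in B) (y < x)%N)%N.

Definition ext_sgn A B : K :=
  if [disjoint A & B] then (-1) ^+ inversions A B else 0.

Definition ext_mul a b : ext K n :=
  \sum_A \sum_B (coef A a * coef B b * ext_sgn A B) *: mono (A :|: B).

Lemma coefZD k a b S : coef S (k *: a + b) = k * coef S a + coef S b.
Proof. by rewrite /coef !ffunE. Qed.

Lemma coef_mono A S : coef S (mono A) = (S == A)%:R.
Proof. by rewrite /coef ffunE. Qed.

Lemma ext_eqP a b : (forall S, coef S a = coef S b) -> a = b.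
Proof. by move=> eq_ab; apply/ffunP=> S; apply: eq_ab. Qed.

Lemma coef_is_linear S : linear (coef S : ext K n -> K^o).
Proof. by move=> k a b; apply: coefZD. Qed.

HB.instance Definition _ S := GRing.isSemilinear.Build K (ext K n) K^o _
  (coef S) (GRing.semilinear_linear (coef_is_linear S)).

Lemma ext_sum_mono a : a = \sum_S coef S a *: mono S.
Proof.
apply: ext_eqP => T.
rewrite (raddf_sum (coef T : {linear ext K n -> K^o})) /= (bigD1 T) //=.
rewrite big1 ?addr0 => [|S neST].
  by rewrite -[_ *: _]addr0 coefZD coef_mono eqxx mulr1 /coef ffunE addr0.
by rewrite -[_ *: _]addr0 coefZD coef_mono eq_sym (negPf neST) mulr0 /coef ffunE addr0.
Qed.

Lemma ext_mul_linearl b : linear (ext_mul^~ b).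
Proof.
move=> k a c; rewrite /ext_mul scaler_sumr -big_split; apply: eq_bigr => A _.
rewrite scaler_sumr -big_split; apply: eq_bigr => B _.
by rewrite coefZD !mulrDl scalerDl scalerA !mulrA.
Qed.

Lemma ext_mul_linearr a : linear (ext_mul a).
Proof.
move=> k b c; rewrite /ext_mul scaler_sumr -big_split; apply: eq_bigr => A _.
rewrite scaler_sumr -big_split; apply: eq_bigr => B _.
by rewrite coefZD mulrDr mulrDl scalerDl scalerA !mulrA [k * coef A a]mulrC.
Qed.

Definition ext_mulr b a := ext_mul a b.
HB.instance Definition _ b := GRing.isSemilinear.Build K (ext K n) (ext K n) _
  (ext_mulr b) (GRing.semilinear_linear (ext_mul_linearl b)).
HB.instance Definition _ a := GRing.isSemilinear.Build K (ext K n) (ext K n) _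
  (ext_mul a) (GRing.semilinear_linear (ext_mul_linearr a)).

Lemma ext_mulZl (k : K) a b : ext_mul (k *: a) b = k *: ext_mul a b.
Proof. exact: (linearZ_LR (ext_mulr b : {linear ext K n -> ext K n})). Qed.

Lemma ext_mulZr (k : K) a b : ext_mul a (k *: b) = k *: ext_mul a b.
Proof. exact: (linearZ_LR (ext_mul a : {linear ext K n -> ext K n})). Qed.

Lemma ext_mul_mono A B :
  ext_mul (mono A) (mono B) = ext_sgn A B *: mono (A :|: B).
Proof.
rewrite /ext_mul (bigD1 A) //= (bigD1 B) //= !coef_mono !eqxx !mul1r.
rewrite !big1 ?addr0 // => [C neCA | C neCB].
  by apply: big1 => D _; rewrite coef_mono (negPf neCA) !mul0r scale0r.
by rewrite [coef C _]coef_mono (negPf neCB) mulr0 mul0r scale0r.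
Qed.

Lemma ext_linear_eq (V : lmodType K) (f g : {linear ext K n -> V}) :
  (forall S, f (mono S) = g (mono S)) -> forall a, f a = g a.
Proof.
move=> eq_fg a; rewrite [a]ext_sum_mono !linear_sum; apply: eq_bigr => S _.
by rewrite !linearZ_LR /= eq_fg.
Qed.

Lemma inversionsUl A B C : [disjoint A & B] ->
  inversions (A :|: B) C = (inversions A C + inversions B C)%N.
Proof. by move=> dAB; rewrite /inversions -bigU //=; apply: eq_bigl => x; rewrite inE. Qed.

Lemma inversionsUr A B C : [disjoint B & C] ->
  inversions A (B :|: C) = (inversions A B + inversions A C)%N.
Proof.
move=> dBC; rewrite /inversions -big_split; apply: eq_bigr => x _.
by rewrite -bigU //=; apply: eq_bigl => y; rewrite inE.
Qed.

Lemma ext_sgnA A B C :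
  ext_sgn A B * ext_sgn (A :|: B) C = ext_sgn B C * ext_sgn A (B :|: C).
Proof.
rewrite /ext_sgn.
have dU: [disjoint A :|: B & C] = [disjoint A & C] && [disjoint B & C].
  by rewrite -!setI_eq0 setIUl setU_eq0.
have dU': [disjoint A & B :|: C] = [disjoint A & B] && [disjoint A & C].
  by rewrite -!setI_eq0 setIUr setU_eq0.
rewrite dU dU'.
case: (boolP [disjoint A & B]) => dAB /=; last by rewrite mul0r mulr0.
case: (boolP [disjoint B & C]) => dBC /=; last by rewrite andbF mul0r mulr0.
case: (boolP [disjoint A & C]) => dAC /=; last by rewrite !mulr0.
rewrite -!exprD inversionsUl // inversionsUr //; congr (_ ^+ _).
by rewrite addnA addnC.
Qed.

Lemma ext_mulA : associative ext_mul.
Proof.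
have monoA A B C : ext_mul (mono A) (ext_mul (mono B) (mono C))
                 = ext_mul (ext_mul (mono A) (mono B)) (mono C).
  rewrite !ext_mul_mono ext_mulZr ext_mulZl !ext_mul_mono.
  by rewrite !scalerA ext_sgnA setUA.
move=> a b c.
pose L1 b c : {linear ext K n -> ext K n} := ext_mulr (ext_mul b c).
pose R1 b c : {linear ext K n -> ext K n} := ext_mulr c \o ext_mulr b.
apply: (@ext_linear_eq _ (L1 b c) (R1 b c)) => A /=.
pose L2 c : {linear ext K n -> ext K n} := ext_mul (mono A) \o ext_mulr c.
pose R2 c : {linear ext K n -> ext K n} := ext_mulr c \o ext_mul (mono A).
apply: (@ext_linear_eq _ (L2 c) (R2 c)) => B /=.
pose L3 : {linear ext K n -> ext K n} := ext_mul (mono A) \o ext_mul (mono B).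
pose R3 : {linear ext K n -> ext K n} := ext_mul (ext_mul (mono A) (mono B)).
by apply: (@ext_linear_eq _ L3 R3) => C /=.
Qed.

Lemma ext_sgn0l A : ext_sgn set0 A = 1.
Proof. by rewrite /ext_sgn /inversions -setI_eq0 set0I eqxx big_set0. Qed.

Lemma ext_sgn0r A : ext_sgn A set0 = 1.
Proof.
rewrite /ext_sgn /inversions -setI_eq0 setI0 eqxx big1 // => x _.
by rewrite big_set0.
Qed.

Lemma ext_mul1l : left_id (mono set0) ext_mul.
Proof.
move=> a.
pose L : {linear ext K n -> ext K n} := ext_mul (mono set0).
apply: (@ext_linear_eq _ L (idfun : {linear ext K n -> ext K n})) => A /=.
by rewrite ext_mul_mono ext_sgn0l scale1r set0U.
Qed.

Lemma ext_mul1r : right_id (mono set0) ext_mul.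
Proof.
move=> a.
pose L : {linear ext K n -> ext K n} := ext_mulr (mono set0).
apply: (@ext_linear_eq _ L (idfun : {linear ext K n -> ext K n})) => A /=.
by rewrite /ext_mulr ext_mul_mono ext_sgn0r scale1r setU0.
Qed.

Lemma ext_mulDl : left_distributive ext_mul +%R.
Proof. by move=> a b c; apply: (raddfD (ext_mulr c : {linear _ -> _})). Qed.

Lemma ext_mulDr : right_distributive ext_mul +%R.
Proof. by move=> a b c; apply: raddfD. Qed.

Lemma ext_one_neq0 : mono set0 != 0.
Proof.
apply/eqP=> /(congr1 (coef set0)); rewrite coef_mono eqxx /coef ffunE.
by move/eqP; rewrite oner_eq0.
Qed.

HB.instance Definition _ := GRing.Zmodule_isNzRing.Build (ext K n)
  ext_mulA ext_mul1l ext_mul1r ext_mulDl ext_mulDr ext_one_neq0.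

Lemma ext_scalerAl (k : K) a b : k *: (a * b) = (k *: a) * b.
Proof. by rewrite -ext_mulZl. Qed.

Lemma ext_scalerAr (k : K) a b : k *: (a * b) = a * (k *: b).
Proof. by rewrite -ext_mulZr. Qed.

HB.instance Definition _ :=
  GRing.Lmodule_isLalgebra.Build K (ext K n) ext_scalerAl.
HB.instance Definition _ :=
  GRing.Lalgebra_isAlgebra.Build K (ext K n) ext_scalerAr.
HB.instance Definition _ := Algebra_isFalgebra.Build K (ext K n).

Lemma mono_mul A B : mono A * mono B = ext_sgn A B *: mono (A :|: B).
Proof. exact: ext_mul_mono. Qed.

Lemma evar_sqr i : evar i * evar i = 0.
Proof.
by rewrite mono_mul /ext_sgn disjoints1 inE eqxx scale0r.
Qed.

Lemma evar_anticomm i j : i != j -> evar i * evar j = - (evar j * evar i).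
Proof.
move=> neij; rewrite !mono_mul setUC -scaleNr; congr (_ *: _).
rewrite /ext_sgn !disjoints1 !inE [j == i]eq_sym (negPf neij) /=.
rewrite /inversions !big_set1; move: neij.
by rewrite -val_eqE /= neq_ltn => /orP[] lt_ij; rewrite lt_ij ltnNge ltnW //= expr1 ?opprK.
Qed.

(* deg e_i = 1, so e_S has degree #|S|. *)
Definition ext_gr (i : int) : {vspace ext K n} :=
  (\sum_(S : {set 'I_n} | (#|S|%:Z == i)) <[mono S]>)%VS.

Lemma mono_gr S : mono S \in ext_gr #|S|%:Z.
Proof. by rewrite memvE /ext_gr (sumv_sup S). Qed.

Lemma ext_gr_ind i (P : ext K n -> Prop) :
    P 0 -> (forall k a b, P a -> P b -> P (k *: a + b)) ->
    (forall S, #|S|%:Z = i -> P (mono S)) ->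
  forall a, a \in ext_gr i -> P a.
Proof.
move=> P0 PD Pmono a /memv_sumP[f fP ->]; apply: (big_ind P) => // [x y Px Py|S].
  by rewrite -[x]scale1r; apply: PD.
move=> Si; have /vlineP[k ->] := fP S Si.
by rewrite -[_ *: _]addr0; apply: PD => //; apply/Pmono/eqP.
Qed.

Lemma ext_gr_mul i j a b :
  a \in ext_gr i -> b \in ext_gr j -> a * b \in ext_gr (i + j).
Proof.
move=> ai bj; move: a ai; apply: ext_gr_ind => [|k a c Pa Pc|A Ai].
- by rewrite mul0r mem0v.
- by rewrite mulrDl -scalerAl memvD ?memvZ.
move: b bj; apply: ext_gr_ind => [|k a c Pa Pc|B Bj].
- by rewrite mulr0 mem0v.
- by rewrite mulrDr -scalerAr memvD ?memvZ.
rewrite mono_mul /ext_sgn; case: ifP => [dAB|_]; last by rewrite scale0r mem0v.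
have -> : i + j = #|A :|: B|%:Z.
  by rewrite -Ai -Bj cardsU disjoint_setI0 // cards0 subn0 PoszD.
by rewrite memvZ ?mono_gr.
Qed.

End ExteriorAlgebra.

Arguments ext_gr {K n} i.

(* V = \bigoplus_(i : int) V_i, elementwise; V is finite dimensional, so only *)
(* the finitely many degrees in t contribute.                                 *)
Definition is_grading (K : fieldType) (V : vectType K)
    (V_ : int -> {vspace V}) : Prop :=
  (exists2 t : seq int, uniq t & forall x : V, exists2 y : int -> V,
     (forall i, y i \in V_ i) & x = \sum_(i <- t) y i)
  /\ (forall (t : seq int) (y : int -> V), uniq t ->
        (forall i, y i \in V_ i) -> \sum_(i <- t) y i = 0 ->
      forall i, i \in t -> y i = 0).

(* U contains the homogeneous components of its elements. *)
Definition homogeneous_sub (K : fieldType) (V : vectType K)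
    (V_ : int -> {vspace V}) (U : {vspace V}) : Prop :=
  forall (t : seq int) (y : int -> V), uniq t ->
    (forall i, y i \in V_ i) -> \sum_(i <- t) y i \in U ->
  forall i, i \in t -> y i \in U.

(* Finitely generated graded E-modules. As E is finite dimensional, these are *)
(* the graded E-modules of finite dimension over K. Only the left action is   *)
(* recorded: the right one is determined by a m = (-1)^(deg a deg m) m a.     *)
Record gmodule (K : fieldType) (n : nat) := GModule {
  gcar :> vectType K;
  act : 'Hom(ext K n, 'End(gcar));
  gr : int -> {vspace gcar};
  act1 : act 1 = \1%VF;
  actM : forall a b, act (a * b) = (act a \o act b)%VF;
  act_gr : forall i j a m,
    a \in ext_gr i -> m \in gr j -> act a m \in gr (i + j);
  gr_grading : is_grading gr }.

Arguments act {K n} g.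
Arguments gr {K n} g i.

Record gsubmodule (K : fieldType) (n : nat) (M : gmodule K n) := GSubmodule {
  gsub_vs :> {vspace M};
  gsub_act : forall a m, m \in gsub_vs -> act M a m \in gsub_vs;
  gsub_gr : homogeneous_sub (gr M) gsub_vs }.

Section GradedModules.
Variables (K : fieldType) (n : nat).
Implicit Types (M N : gmodule K n).

Lemma homogeneous_subP (V : vectType K) (V_ : int -> {vspace V})
    (U : {vspace V}) : is_grading V_ ->
    (forall x, x \in U -> exists t, exists2 y : int -> V,
       forall i, y i \in V_ i /\ y i \in U & uniq t /\ x = \sum_(i <- t) y i) ->
  homogeneous_sub V_ U.
Proof.
move=> [_ indep] Udec t y t_uniq yV sum_yU i ti.
have [u [z zVU [u_uniq sum_yz]]] := Udec _ sum_yU.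
pose w j := (if j \in t then y j else 0) - (if j \in u then z j else 0).
pose r := undup (t ++ u).
have sum_ext (v : seq int) (f : int -> V) : uniq v -> {subset v <= r} ->
    \sum_(j <- v) f j = \sum_(j <- r) (if j \in v then f j else 0).
  move=> v_uniq sub_vr; rewrite -big_mkcond -big_filter; apply: perm_big.
  apply: uniq_perm => // [|j]; first by rewrite filter_uniq ?undup_uniq.
  by rewrite mem_filter; case: (boolP (j \in v)) => //= /sub_vr ->.
have sub_t : {subset t <= r} by move=> j tj; rewrite mem_undup mem_cat tj.
have sub_u : {subset u <= r} by move=> j uj; rewrite mem_undup mem_cat uj orbT.
have : w i = 0.
  apply: (indep r) => [|j||]; first exact: undup_uniq.
  - by rewrite /w rpredB //; case: ifP => _; rewrite ?mem0v //; case: (zVU j).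
  - by rewrite sumrB -(sum_ext t) // -(sum_ext u) // sum_yz subrr.
  - exact: sub_t.
rewrite /w ti => /eqP.
rewrite subr_eq0 => /eqP ->; case: ifP => _; rewrite ?mem0v //.
by case: (zVU i).
Qed.

Lemma ext_grading : is_grading (@ext_gr K n).
Proof.
split.
  exists [seq i%:Z | i <- iota 0 n.+1].
    by rewrite map_inj_uniq ?iota_uniq // => i j [].
  move=> x; exists (fun i => \sum_(S : {set 'I_n} | #|S|%:Z == i)
                              coef S x *: mono K S) => [i|].
    apply: rpred_sum => S /eqP <-; exact/memvZ/mono_gr.
  rewrite big_map {1}[x]ext_sum_mono.
  rewrite (exchange_big_dep predT) //=; apply: eq_bigr => S _.
  have Sn : #|S| \in iota 0 n.+1.
    by rewrite mem_iota ltnS (leq_trans (max_card _)) ?card_ord.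
  rewrite big_mkcond (bigD1_seq _ Sn) ?iota_uniq //=.
  rewrite eqxx big1 ?addr0 // => i neiS.
  by case: eqP => // -[eSi]; rewrite eSi eqxx in neiS.
move=> t y t_uniq yE sum0 i ti; apply: ext_eqP => S.
have coef_gr j a : a \in @ext_gr K n j -> #|S|%:Z != j -> coef S a = 0.
  move=> aj neSj; move: a aj; apply: ext_gr_ind => [|k a b Pa Pb|T Tj].
  - by rewrite /coef ffunE.
  - by rewrite coefZD Pa Pb mulr0 addr0.
  rewrite coef_mono; case: eqP => // eST; case/eqP: neSj; by rewrite eST.
have [Si|neSi] := eqVneq #|S|%:Z i; last first.
  by rewrite (coef_gr i) // /coef ffunE.
have := congr1 (coef S) sum0.
rewrite (raddf_sum (coef S : {linear ext K n -> K^o})) /=.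
rewrite (bigD1_seq i) //= big1 ?addr0 // => j neji.
by rewrite (coef_gr j) // Si eq_sym.
Qed.

Lemma ext_act1 : linfun (@amull K (ext K n)) 1 = \1%VF.
Proof. by rewrite lfunE /= amull1. Qed.

Lemma ext_actM a b : linfun (@amull K (ext K n)) (a * b)
  = (linfun (@amull K (ext K n)) a \o linfun (@amull K (ext K n)) b)%VF.
Proof. by apply/lfunP=> c; rewrite comp_lfunE !lfunE /= mulrA. Qed.

Lemma ext_act_gr i j (a m : ext K n) : a \in ext_gr i -> m \in ext_gr j ->
  linfun (@amull K (ext K n)) a m \in ext_gr (i + j).
Proof. by move=> ai mj; rewrite lfunE /= lfunE /= ext_gr_mul. Qed.

Definition ext_mod : gmodule K n :=
  GModule ext_act1 ext_actM ext_act_gr ext_grading.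

Section Shift.
Variables (M : gmodule K n) (a : int).

Definition shift_gr i := gr M (a + i).

Lemma shift_act_gr i j b m : b \in ext_gr i -> m \in shift_gr j ->
  act M b m \in shift_gr (i + j).
Proof. by move=> bi mj; rewrite /shift_gr addrCA act_gr. Qed.

Lemma shift_grading : is_grading shift_gr.
Proof.
have [[t t_uniq tP] indep] := gr_grading M; split.
  exists [seq i - a | i <- t]; first by rewrite map_inj_uniq // => i j /addIr.
  move=> x; have [y yM ->] := tP x.
  exists (fun i => y (a + i)) => [i|]; first exact: yM.
  by rewrite big_map; apply: eq_bigr => i _; rewrite addrC subrK.
move=> t' y t'_uniq yM sum0 i ti.
have := indep [seq a + i | i <- t'] (fun i => y (i - a)).
rewrite map_inj_uniq; last exact: addrI.
rewrite big_map; under eq_bigr => j _ do rewrite [a + j - a]addrC addKr.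
move=> /(_ t'_uniq) indep'.
have := indep' _ sum0 (a + i); rewrite mem_map; last exact: addrI.
rewrite [a + i - a]addrC addKr; apply=> // j.
by have := yM (j - a); rewrite /shift_gr [a + _]addrC subrK.
Qed.

Definition shift : gmodule K n :=
  GModule (act1 M) (@actM _ _ M) shift_act_gr shift_grading.
End Shift.

Section Power.
Variables (M : gmodule K n) (k : nat).
Let V : vectType K := {ffun 'I_k -> M}.

Definition pow_map (f : 'End(M)) (x : V) : V := [ffun l => f (x l)].

Lemma pow_map_is_linear f : linear (pow_map f).
Proof. by move=> c x y; apply/ffunP=> l; rewrite !ffunE linearP. Qed.
HB.instance Definition _ f := GRing.isSemilinear.Build K V V _
  (pow_map f) (GRing.semilinear_linear (pow_map_is_linear f)).

Definition pow_act_fun (a : ext K n) : 'End(V) := linfun (pow_map (act M a)).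

Lemma pow_act_is_linear : linear pow_act_fun.
Proof.
move=> c a b; apply/lfunP=> x; rewrite add_lfunE scale_lfunE !lfunE /=.
by apply/ffunP=> l; rewrite !ffunE linearP add_lfunE scale_lfunE.
Qed.
HB.instance Definition _ := GRing.isSemilinear.Build K (ext K n) 'End(V) _
  pow_act_fun (GRing.semilinear_linear pow_act_is_linear).

Definition pow_proj (l : 'I_k) (x : V) : M := x l.
Lemma pow_proj_is_linear l : linear (pow_proj l).
Proof. by move=> c x y; rewrite /pow_proj !ffunE. Qed.
HB.instance Definition _ l := GRing.isSemilinear.Build K V M _
  (pow_proj l) (GRing.semilinear_linear (pow_proj_is_linear l)).

(* The families whose entries all lie in M_i. *)
Definition pow_gr (i : int) : {vspace V} :=
  (\bigcap_(l < k) (linfun (pow_proj l) @^-1: gr M i))%VS.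

Lemma mem_pow_gr i (x : V) :
  reflect (forall l, x l \in gr M i) (x \in pow_gr i).
Proof.
have mem_pre l : (x \in (linfun (pow_proj l) @^-1: gr M i)%VS) = (x l \in gr M i).
  by rewrite -memv_preim lfunE.
rewrite memvE; apply: (iffP subv_bigcapP) => [h l|h l _].
  by rewrite -mem_pre memvE; apply: h.
by rewrite -memvE mem_pre.
Qed.

Lemma pow_act1 : linfun pow_act_fun 1 = \1%VF.
Proof.
apply/lfunP=> x; rewrite !lfunE /=.
by apply/ffunP=> l; rewrite ffunE act1 lfunE.
Qed.

Lemma pow_actM a b : linfun pow_act_fun (a * b)
  = (linfun pow_act_fun a \o linfun pow_act_fun b)%VF.
Proof.
apply/lfunP=> x; rewrite comp_lfunE !lfunE /=.
by apply/ffunP=> l; rewrite !ffunE actM comp_lfunE.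
Qed.

Lemma pow_act_gr i j a m : a \in ext_gr i -> m \in pow_gr j ->
  linfun pow_act_fun a m \in pow_gr (i + j).
Proof.
move=> ai /mem_pow_gr mj; apply/mem_pow_gr=> l.
by rewrite lfunE /= lfunE /= ffunE act_gr.
Qed.

Lemma pow_grading : is_grading pow_gr.
Proof.
have [[t t_uniq tP] indep] := gr_grading M; split.
  exists t => // x.
  have /fin_all_exists[y yP] l : exists y : int -> M,
      (forall i, y i \in gr M i) /\ x l = \sum_(i <- t) y i.
    by have [y ? ?] := tP (x l); exists y.
  exists (fun i => [ffun l => y l i]) => [i|].
    by apply/mem_pow_gr=> l; rewrite ffunE; case: (yP l).
  apply/ffunP=> l; rewrite sum_ffunE; have [_ ->] := yP l.
  by apply: eq_bigr => i _; rewrite ffunE.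
move=> t' y t'_uniq yV sum0 i ti; apply/ffunP=> l; rewrite ffunE.
apply: (indep t' (fun i => y i l)) => // [j|]; first exact/mem_pow_gr.
by have := congr1 (fun f : V => f l) sum0; rewrite sum_ffunE ffunE.
Qed.

Definition gpow : gmodule K n :=
  GModule pow_act1 pow_actM pow_act_gr pow_grading.
End Power.

Section Quotient.
(* The carrier of M / N is a vector space complement of N in M; quot_proj is  *)
(* the canonical surjection M -> M / N.                                       *)
Variables (M : gmodule K n) (N : gsubmodule M).
Let V : vectType K := subvs_of (N^C)%VS.

Definition quot_proj_fun (m : M) : V := vsproj (N^C)%VS (m - projv N m).

Lemma quot_proj_is_linear : linear quot_proj_fun.
Proof.
move=> c x y; rewrite /quot_proj_fun -linearP; congr (vsproj _ _).
by rewrite linearP scalerBr opprD addrACA.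
Qed.
HB.instance Definition _ := GRing.isSemilinear.Build K M V _
  quot_proj_fun (GRing.semilinear_linear quot_proj_is_linear).

Definition quot_proj : 'Hom(M, V) := linfun quot_proj_fun.

Lemma vsval_quot_proj m : vsval (quot_proj m) = m - projv N m.
Proof. by rewrite lfunE /= /quot_proj_fun vsprojK // memv_projC. Qed.

Lemma quot_proj_eq0 m : (quot_proj m == 0) = (m \in (N : {vspace M})).
Proof.
rewrite -(inj_eq val_inj) /= vsval_quot_proj subr_eq0.
by apply/eqP/idP=> [->|/projv_id->//]; rewrite memv_proj.
Qed.

Lemma vsvalK_quot (x : V) : quot_proj (vsval x) = x.
Proof.
apply: val_inj; rewrite /= vsval_quot_proj.
suff -> : projv N (vsval x) = 0 by rewrite subr0.
by apply/eqP; rewrite -memv_ker lker_proj subvsP.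
Qed.

Lemma quot_projP m1 m2 : m1 - m2 \in (N : {vspace M}) ->
  quot_proj m1 = quot_proj m2.
Proof. by rewrite -quot_proj_eq0 linearB subr_eq0 => /eqP. Qed.

Lemma quot_proj_sub m : vsval (quot_proj m) - m \in (N : {vspace M}).
Proof. by rewrite vsval_quot_proj addrC addKr memvN memv_proj. Qed.

Definition quot_act_map (f : 'End(M)) (x : V) : V := quot_proj (f (vsval x)).

Lemma quot_act_map_is_linear f : linear (quot_act_map f).
Proof. by move=> c x y; rewrite /quot_act_map !linearP. Qed.
HB.instance Definition _ f := GRing.isSemilinear.Build K V V _
  (quot_act_map f) (GRing.semilinear_linear (quot_act_map_is_linear f)).

Definition quot_act_fun (a : ext K n) : 'End(V) :=
  linfun (quot_act_map (act M a)).

Lemma quot_act_is_linear : linear quot_act_fun.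
Proof.
move=> c a b; apply/lfunP=> x; rewrite add_lfunE scale_lfunE !lfunE /=.
by rewrite /quot_act_map linearP add_lfunE scale_lfunE linearP.
Qed.
HB.instance Definition _ := GRing.isSemilinear.Build K (ext K n) 'End(V) _
  quot_act_fun (GRing.semilinear_linear quot_act_is_linear).

Definition quot_act : 'Hom(ext K n, 'End(V)) := linfun quot_act_fun.

Lemma quot_actE a m : quot_act a (quot_proj m) = quot_proj (act M a m).
Proof.
rewrite lfunE /= lfunE /= /quot_act_map; apply: quot_projP.
by rewrite -linearB gsub_act ?quot_proj_sub.
Qed.

Definition quot_gr (i : int) : {vspace V} := (quot_proj @: gr M i)%VS.

Lemma quot_act1 : quot_act 1 = \1%VF.
Proof.
by apply/lfunP=> x; rewrite -(vsvalK_quot x) quot_actE act1 !lfunE.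
Qed.

Lemma quot_actM a b : quot_act (a * b) = (quot_act a \o quot_act b)%VF.
Proof.
apply/lfunP=> x; rewrite -(vsvalK_quot x) comp_lfunE !quot_actE.
by rewrite actM comp_lfunE.
Qed.

Lemma quot_act_gr i j a m : a \in ext_gr i -> m \in quot_gr j ->
  quot_act a m \in quot_gr (i + j).
Proof.
by move=> ai /memv_imgP[x xj ->]; rewrite quot_actE memv_img ?act_gr.
Qed.

Lemma quot_grading : is_grading quot_gr.
Proof.
have [[t t_uniq tP] indep] := gr_grading M; split.
  exists t => // x; have [y yM xE] := tP (vsval x).
  exists (fun i => quot_proj (y i)) => [i|]; first exact: memv_img.
  by rewrite -{1}(vsvalK_quot x) xE linear_sum.
move=> t' y t'_uniq yV sum0.
have z_ex i : exists z : M, (z \in gr M i) && (y i == quot_proj z).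
  by have /memv_imgP[z zi ->] := yV i; exists z; rewrite zi eqxx.
pose z i := xchoose (z_ex i).
have zP i : (z i \in gr M i) && (y i == quot_proj (z i)) := xchooseP (z_ex i).
have yE i : y i = quot_proj (z i) by case/andP: (zP i) => _ /eqP.
move=> i ti; apply/eqP; rewrite yE quot_proj_eq0.
apply: (gsub_gr (g := N) t'_uniq) => // [j|]; first by case/andP: (zP j).
rewrite -quot_proj_eq0 linear_sum; apply/eqP; rewrite -[RHS]sum0.
by apply: eq_bigr => j _; rewrite yE.
Qed.

Definition quot : gmodule K n :=
  GModule quot_act1 quot_actM quot_act_gr quot_grading.
End Quotient.

Definition linform : vectType K := subvs_of (@ext_gr K n 1).

Lemma card_inversions1 (S : {set 'I_n}) i : i \notin S ->
  (inversions S [set i] + inversions [set i] S = #|S|)%N.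
Proof.
move=> iS; rewrite /inversions big_set1 -big_split /= -sum1_card.
apply: eq_bigr => x xS; rewrite big_set1.
have : x != i by apply: contraNneq iS => <-.
by rewrite -val_eqE /= neq_ltn; case: ltngtP.
Qed.

(* Right multiplication by a linear form is left multiplication by it, up to  *)
(* the grading involution.                                                    *)
Definition ext_inv_fun (a : ext K n) : ext K n :=
  \sum_(S : {set 'I_n}) ((-1) ^+ #|S| * coef S a) *: mono K S.

Lemma linform_comm (a v : ext K n) : v \in ext_gr 1 ->
  a * v = v * ext_inv_fun a.
Proof.
move: v; apply: ext_gr_ind => [|k u v Pu Pv|T T1].
- by rewrite mulr0 mul0r.
- by rewrite mulrDr mulrDl -scalerAr -scalerAl Pu Pv.
have /eqP/cards1P[i ->] : #|T| = 1%N by case: T1.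
rewrite {1}[a]ext_sum_mono mulr_suml mulr_sumr; apply: eq_bigr => S _.
rewrite -scalerAl -scalerAr !mono_mul !scalerA setUC; congr (_ *: _).
rewrite /ext_sgn disjoints1 disjoint_sym disjoints1.
case: (boolP (i \in S)) => iS /=; first by rewrite !mulr0.
rewrite -(card_inversions1 iS) [_ * coef S a]mulrC -mulrA -exprD -addnA addnn.
by rewrite exprD -mul2n exprM sqrrN expr1n expr1n mulr1.
Qed.

Section FormsTimesModule.
Variables (M : gmodule K n) (vs : seq linform).

Definition lin_sub_vs : {vspace M} :=
  (\sum_(v <- vs) limg (act M (vsval v)))%VS.

Lemma lin_sub_ind (P : M -> Prop) :
    P 0 -> (forall x y, P x -> P y -> P (x + y)) ->
    (forall v m, v \in vs -> P (act M (vsval v) m)) ->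
  forall x, x \in lin_sub_vs -> P x.
Proof.
move=> P0 PD; rewrite /lin_sub_vs; elim: vs => [|v s IH] Pv x.
  by rewrite big_nil memv0 => /eqP ->.
rewrite big_cons => /memv_addP[y /memv_imgP[m _ ->] [z zs ->]].
apply: PD; first by apply: Pv; rewrite mem_head.
by apply: IH zs => w m' ws; apply: Pv; rewrite in_cons ws orbT.
Qed.

Lemma lin_sub_mem v m : v \in vs -> act M (vsval v) m \in lin_sub_vs.
Proof.
move=> vvs; rewrite /lin_sub_vs (big_rem v) //= memvE.
by apply: subv_trans (addvSl _ _); rewrite -memvE memv_img ?memvf.
Qed.

Lemma lin_sub_act a m : m \in lin_sub_vs -> act M a m \in lin_sub_vs.
Proof.
move: m; apply: lin_sub_ind => [|x y|v m vvs].
- by rewrite linear0 mem0v.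
- by rewrite linearD; apply: memvD.
rewrite -comp_lfunE -actM linform_comm ?subvsP // actM comp_lfunE.
exact: lin_sub_mem.
Qed.

Lemma lin_sub_gr : homogeneous_sub (gr M) lin_sub_vs.
Proof.
have grM := gr_grading M; have [[t t_uniq tP] _] := grM.
apply: homogeneous_subP => // x xU; exists [seq 1 + i | i <- t].
suff [y yP xE] : exists2 y : int -> M,
    forall i, y i \in gr M i /\ y i \in lin_sub_vs &
    x = \sum_(i <- [seq 1 + i | i <- t]) y i.
  by exists y => //; split=> //; rewrite map_inj_uniq //; apply: addrI.
move: x xU; apply: lin_sub_ind => [|x1 x2 [y1 y1P ->] [y2 y2P ->]|v m vvs].
- exists (fun _ => 0) => [i|]; first by rewrite !mem0v.
  by rewrite big1.
- exists (fun i => y1 i + y2 i) => [i|]; last by rewrite big_split.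
  by have [? ?] := y1P i; have [? ?] := y2P i; split; apply: memvD.
have [y yM ->] := tP m; exists (fun i => act M (vsval v) (y (i - 1))) => [i|].
  split; last exact: lin_sub_mem.
  by have := act_gr (subvsP v) (yM (i - 1)); rewrite [1 + (i - 1)]addrC subrK.
rewrite big_map linear_sum; apply: eq_bigr => i _.
by rewrite [1 + i]addrC addrK.
Qed.

Definition lin_sub : gsubmodule M := GSubmodule lin_sub_act lin_sub_gr.
End FormsTimesModule.

Definition regular_elt M (v : linform) : Prop :=
  lker (act M (vsval v)) = limg (act M (vsval v)).

Definition regular_seq M (vs : seq linform) : Prop :=
  (forall i, (i < size vs)%N ->
     regular_elt (quot (lin_sub M (take i vs))) vs`_i)
  /\ {:quot (lin_sub M vs)}%VS != 0%VS.

Definition maximal_regular_seq M (vs : seq linform) : Prop :=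
  regular_seq M vs /\ forall v, ~ regular_seq M (rcons vs v).

(* depth M = s is a relation: by the theory of regular sequences all maximal  *)
(* M-regular sequences have the same length, so that s is determined by M.    *)
Definition has_depth M (s : nat) : Prop :=
  exists2 vs, maximal_regular_seq M vs & size vs = s.

(* Homomorphisms are homogeneous of degree 0. *)
Definition ghom M N (f : 'Hom(M, N)) : Prop :=
  (forall a m, f (act M a m) = act N a (f m))
  /\ (forall i, (f @: gr M i <= gr N i)%VS).

Definition giso M N : Prop :=
  exists f : 'Hom(M, N), exists g : 'Hom(N, M),
    [/\ ghom f, ghom g, cancel f g & cancel g f].

Definition ginjective (I : gmodule K n) : Prop :=
  forall M N (f : 'Hom(M, N)) (g : 'Hom(M, I)),
    ghom f -> ghom g -> lker f = 0%VS ->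
  exists2 h : 'Hom(N, I), ghom h & forall m, h (f m) = g m.

Definition gessential M (U : {vspace M}) : Prop :=
  forall N : gsubmodule M, (N : {vspace M}) != 0%VS -> (N :&: U)%VS != 0%VS.

(* 0 -> M -> I^0 -> I^1 -> ... is exact with injective terms, and minimal:    *)
(* each I^i is an injective hull of ker (I^i -> I^(i+1)).                     *)
Definition min_inj_resolution M (I : nat -> gmodule K n) (eps : 'Hom(M, I 0%N))
    (d : forall i, 'Hom(I i, I i.+1)) : Prop :=
  [/\ ghom eps /\ forall i, ghom (d i),
      forall i, ginjective (I i),
      [/\ lker eps = 0%VS, limg eps = lker (d 0%N)
        & forall i, limg (d i) = lker (d i.+1)]
    & forall i, gessential (lker (d i))].

Definition linear_inj_resolution M : Prop :=
  exists (I : nat -> gmodule K n) (eps : 'Hom(M, I 0%N))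
         (d : forall i, 'Hom(I i, I i.+1)),
    min_inj_resolution eps d /\
    exists (c : int) (mu : nat -> nat), forall i : nat,
      giso (I i) (gpow (shift ext_mod (n%:Z - c + i%:Z)) (mu i)).

Definition hilbert_series M : int -> int := fun i => (\dim (gr M i))%:Z.

End GradedModules.

Arguments ext_mod {K n}.

Record graded_ideal (K : fieldType) (n : nat) := GradedIdeal {
  ideal_vs :> {vspace ext K n};
  ideal_mull : forall a x, x \in ideal_vs -> a * x \in ideal_vs;
  ideal_mulr : forall a x, x \in ideal_vs -> x * a \in ideal_vs;
  ideal_gr : homogeneous_sub ext_gr ideal_vs }.

Lemma ideal_act (K : fieldType) (n : nat) (J : graded_ideal K n)
    (a : ext K n) (m : ext_mod) :
  m \in (J : {vspace ext K n}) -> act ext_mod a m \in (J : {vspace ext K n}).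
Proof. by move=> mJ; rewrite lfunE /= lfunE /=; apply: ideal_mull. Qed.

Definition ideal_sub (K : fieldType) (n : nat) (J : graded_ideal K n) :
  gsubmodule (@ext_mod K n) :=
  @GSubmodule K n ext_mod J (@ideal_act K n J) (@ideal_gr K n J).

Definition ext_quot (K : fieldType) (n : nat) (J : graded_ideal K n) :
  gmodule K n := quot (ideal_sub J).

(* The formal Laurent series (coefficients indexed by int) of a polynomial. *)
Definition laurent_of_poly (p : {poly int}) : int -> int :=
  fun i => if i is Posz k then p`_k else 0.

(* Main.v *)
(** Multiplication by sum_i e_i x_i turns M (x) K[x_1, ..., x_n] into a complex.
    For E itself it is the Koszul complex, exact except in the top degree, so
    dimension shifting along a linear injective resolution shows that for
    M = E/J it is exact at M_j for all j but one.  This property passes from M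
    to M/vM when v is M-regular (with the exceptional degree lowered by 1),
    hence to N = M/(v_1, ..., v_s)M for a maximal regular sequence.  Over the
    field K(x_1, ..., x_n), and then, K being infinite, for a suitable w in
    E_1, the complex N_j -> N_(j+1) given by w is exact at all j but one.  Its
    Euler characteristic is Q(-1), where Q is the Hilbert series of N.  If
    Q(-1) = 0, the complex is exact everywhere, so that w is N-regular, against
    maximality.  Finally H(M, t) = (1 + t) H(M/vM, t) if v is M-regular. *)
Require Import Defs.
From mathcomp Require Import all_boot all_order all_algebra.
From mathcomp Require Import all_field.
From mathcomp.multinomials Require Import mpoly.

Set Implicit Arguments.
Unset Strict Implicit.
Unset Printing Implicit Defensive.

Import GRing.Theory Num.Theory.
Local Open Scope ring_scope.

(** * Graded projections *)

Section GradedProjection.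
Variables (K : fieldType) (n : nat).
Implicit Types M N : gmodule K n.

Lemma memv_sum_seqP (V : vectType K) (I : eqType) (V_ : I -> {vspace V})
    (t : seq I) x : uniq t -> x \in (\sum_(i <- t) V_ i)%VS ->
  exists2 y : I -> V, forall i, y i \in V_ i & x = \sum_(i <- t) y i.
Proof.
elim: t x => [|k u IH] x /=.
  rewrite big_nil memv0 => _ /eqP->.
  by exists (fun _ => 0) => [k|]; rewrite ?mem0v ?big_nil.
move=> /andP[ku u_uniq]; rewrite big_cons => /memv_addP[a ak [b bu ->]].
have [y yM ->] := IH _ u_uniq bu.
exists (fun l => if l == k then a else y l) => [l|].
  by case: eqP => [->|].
rewrite big_cons eqxx; congr (_ + _); apply: eq_big_seq => l lu.
by case: eqP lu ku => // -> ->.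
Qed.

Lemma memv_sum_seq (V : vectType K) (I : Type) (V_ : I -> {vspace V})
    (t : seq I) (y : I -> V) :
  (forall i, y i \in V_ i) -> \sum_(i <- t) y i \in (\sum_(i <- t) V_ i)%VS.
Proof.
move=> yV; elim: t => [|k u IH]; first by rewrite !big_nil mem0v.
by rewrite !big_cons memv_add.
Qed.

(** [is_grading] gives components for one element at a time; as linear maps they can be compared
    with other maps. *)
Definition graded_projections M (P : int -> 'End(M)) : Prop :=
  [/\ forall i x, P i x \in gr M i,
      forall i j x, x \in gr M j -> P i x = if i == j then x else 0
    & exists2 t : seq int, uniq t & forall x, x = \sum_(i <- t) P i x].

(** [P i] projects onto degree [i] along the sum [W i] of the other degrees in [t]. A degree missing
    from [t] is zero, since it lies in the sum of those listed. *)
Lemma graded_projections_exist M : exists P, @graded_projections M P.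
Proof.
have [[t t_uniq tP] indep] := gr_grading M.
pose W i := (\sum_(k <- rem i t) gr M k)%VS.
(* Independence is applied to the decomposition of [x] over [u], with [- x] added in degree [i]. *)
have notin i u x : uniq u -> i \notin u -> x \in gr M i ->
    x \in (\sum_(k <- u) gr M k)%VS -> x = 0.
  move=> u_uniq iu xi /(memv_sum_seqP u_uniq)[y yM xE].
  pose z k := if k == i then - x else y k.
  have := indep (i :: u) z; rewrite /= iu => /(_ u_uniq) H.
  apply/eqP; rewrite -oppr_eq0; apply/eqP.
  have := H _ _ i (mem_head _ _); rewrite /z eqxx => ->//.
    by move=> k; case: eqP => [->|//]; rewrite memvN.
  rewrite big_cons eqxx {1}xE addrC; apply/eqP; rewrite subr_eq0; apply/eqP.
  by apply: eq_big_seq => k kt; case: eqP kt iu => // -> ->.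
have disj i : (gr M i :&: W i = 0)%VS.
  apply/eqP; rewrite -subv0; apply/subvP=> x; rewrite memv_cap => /andP[xi xW].
  rewrite memv0; apply/eqP/(notin i (rem i t)) => //; rewrite ?rem_uniq //.
  by rewrite mem_rem_uniq // inE eqxx.
have decomp i x : x \in (gr M i + W i)%VS.
  have [y yM ->] := tP x; have [it|it] := boolP (i \in t).
    by rewrite (big_rem i) //= memv_add // memv_sum_seq.
  by rewrite -[X in X \in _]add0r memv_add ?mem0v // /W rem_id // memv_sum_seq.
pose P i := daddv_pi (gr M i) (W i).
have PV i x : P i x \in gr M i by apply: memv_pi.
have Pid i x : x \in gr M i -> P i x = x by apply: daddv_pi_id.
have PW i x : x \in W i -> P i x = 0.
  move=> xW; have := daddv_pi_add (disj i) (decomp i x).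
  rewrite [X in _ + X]daddv_pi_id //; last by rewrite capvC.
  by rewrite /P -{3}[x]add0r => /addIr.
have Pne i j x : x \in gr M j -> i != j -> P i x = 0.
  move=> xj neij; have [jt|jt] := boolP (j \in t).
    apply: PW; rewrite /W (big_rem j) ?mem_rem_uniq ?inE 1?eq_sym ?neij //.
    by apply: subvP xj; apply: addvSl.
  rewrite (notin j t x) ?linear0 //.
  by have [y yM ->] := tP x; rewrite memv_sum_seq.
exists P; split=> //.
  by move=> i j x xj; case: eqP => [->|/eqP neij]; [apply: Pid|apply: Pne xj _].
exists t => // x; have [y yM xE] := tP x; rewrite {1}xE.
apply: eq_big_seq => i it; rewrite xE linear_sum (bigD1_seq i) //= Pid //.
by rewrite big1 ?addr0 // => j neji; apply: Pne (yM j) _; rewrite eq_sym.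
Qed.

Lemma graded_projections_sub M (P : int -> 'End(M)) (U : {vspace M}) :
    graded_projections P -> homogeneous_sub (gr M) U ->
  forall i x, x \in U -> P i x \in U.
Proof.
move=> [PM PE [t t_uniq sumP]] homU i x xU.
have [it|it] := boolP (i \in t).
  by apply: (homU t (fun i => P i x)) it => //; rewrite -sumP.
rewrite [x]sumP linear_sum /= big1_seq ?mem0v // => j /= jt.
by rewrite (PE i j) //; case: eqP it => // ->; rewrite jt.
Qed.

Lemma graded_projections_comm M N (P : int -> 'End(M)) (Q : int -> 'End(N))
    (f : 'Hom(M, N)) (k : int) :
    graded_projections P -> graded_projections Q ->
    (forall i x, x \in gr M i -> f x \in gr N (i + k)) ->
  forall i x, Q (i + k) (f x) = f (P i x).
Proof.
move=> [PM PE [t _ sumP]] [_ QE _] fgr i x; rewrite {1}[x]sumP.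
rewrite {2}[x]sumP !linear_sum /=; apply: eq_bigr => j _.
rewrite (PE i j) // (QE _ (j + k)) ?fgr //.
by rewrite (inj_eq (addIr k)); case: ifP => //; rewrite linear0.
Qed.

End GradedProjection.

(** * The Cartan differential *)
Section LinearForms.
Variables (K : fieldType) (n : nat).

Lemma evar_gr (i : 'I_n) : evar K i \in ext_gr 1.
Proof. by have := mono_gr K [set i]; rewrite cards1. Qed.

Lemma linform_sqr0_anticomm (v : ext K n) : v \in ext_gr 1 ->
  v * v = 0 /\ forall u, u \in ext_gr 1 -> u * v = - (v * u).
Proof.
(* One induction carries all claims: the square of [k *: a + b] leaves the cross terms
   [a * b + b * a], and anticommutativity alone does not give [v * v = 0] in characteristic 2. *)
suff: v \in ext_gr 1 -> v \in ext_gr 1 /\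
    v * v = 0 /\ forall u, u \in ext_gr 1 -> u * v = - (v * u).
  by move=> H /H [].
move: v; apply: ext_gr_ind => [|k a b [a1 [aa aC]] [b1 [bb bC]]|S S1].
- by rewrite mem0v mulr0; split=> //; split=> // u _; rewrite mulr0 mul0r oppr0.
- split; first by rewrite memvD ?memvZ.
  split=> [|u u1]; last first.
    by rewrite mulrDr mulrDl -scalerAr -scalerAl aC // bC // opprD scalerN.
  rewrite mulrDr !mulrDl -!scalerAr -!scalerAl aa bb !scaler0 add0r addr0.
  by rewrite bC // scalerN subrr.
have /eqP/cards1P[i ->] : #|S| = 1%N by case: S1.
split; first exact: evar_gr.
split; first exact: evar_sqr.
move=> u; move: u; apply: ext_gr_ind => [|k a b Pa Pb|T T1].
- by rewrite mulr0 mul0r oppr0.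
- by rewrite mulrDr mulrDl -scalerAr -scalerAl Pa Pb opprD scalerN.
have /eqP/cards1P[j ->] : #|T| = 1%N by case: T1.
have [->|neji] := eqVneq j i; first by rewrite [mono _ _ * _]evar_sqr oppr0.
exact: evar_anticomm.
Qed.

Lemma linform_sqr0 (v : ext K n) : v \in ext_gr 1 -> v * v = 0.
Proof. by case/linform_sqr0_anticomm. Qed.

Lemma linform_anticomm (u v : ext K n) :
  u \in ext_gr 1 -> v \in ext_gr 1 -> u * v = - (v * u).
Proof. by move=> u1 /linform_sqr0_anticomm[_]; apply. Qed.

Section Action.
Variable M : gmodule K n.

Lemma act_act a b (m : M) : act M a (act M b m) = act M (a * b) m.
Proof. by rewrite actM comp_lfunE. Qed.

Lemma act_linform_sqr0 v (m : M) : v \in ext_gr 1 -> act M v (act M v m) = 0.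
Proof. by move=> v1; rewrite act_act linform_sqr0 // linear0 zero_lfunE. Qed.

Lemma act_linform_anticomm u v (m : M) : u \in ext_gr 1 -> v \in ext_gr 1 ->
  act M u (act M v m) = - act M v (act M u m).
Proof.
by move=> u1 v1; rewrite !act_act linform_anticomm // linearN opp_lfunE.
Qed.

End Action.
End LinearForms.

Lemma mdeg_subU (n : nat) (a : 'X_{1..n}) (i : 'I_n) :
  (0 < a i)%N -> (mdeg (a - U_(i))%MM).+1 = mdeg a.
Proof.
move=> ai; rewrite -[in RHS](@submK _ U_(i)%MM a) ?mdegD ?mdeg1 ?addn1 //.
by apply/mnm_lepP=> j; rewrite mnm1E; case: eqP => [<-|].
Qed.

Section Cartan.
Variables (K : fieldType) (n : nat).
Implicit Types M N : gmodule K n.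

(* The differential sum_i e_i x_i of M (x) K[x_1, ..., x_n]; a (formal) power *)
(* series with coefficients in M is the function sending a monomial to its    *)
(* coefficient.                                                               *)
Definition cartan M (F : 'X_{1..n} -> M) (a : 'X_{1..n}) : M :=
  \sum_(i < n | (0 < a i)%N) act M (evar K i) (F (a - U_(i))%MM).

Lemma eq_cartan M (F G : 'X_{1..n} -> M) a :
    (forall b, (mdeg b).+1 = mdeg a -> F b = G b) ->
  cartan F a = cartan G a.
Proof.
move=> eqFG; apply: eq_bigr => i ai; congr (act M _ _); apply: eqFG.
exact: mdeg_subU.
Qed.

Lemma cartan_sub M (U : {vspace M}) (F : 'X_{1..n} -> M) p a :
    (forall b m, m \in U -> act M b m \in U) ->
    (forall b, mdeg b = p -> F b \in U) -> mdeg a = p.+1 -> cartan F a \in U.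
Proof.
move=> actU FU ap; apply: rpred_sum => i ai; apply: actU; apply: FU.
by apply: succn_inj; rewrite mdeg_subU.
Qed.

Lemma cartan0 M (F : 'X_{1..n} -> M) a : mdeg a = 0%N -> cartan F a = 0.
Proof.
move=> a0; apply: big1 => i ai.
by have := mdeg_subU ai; rewrite a0.
Qed.

Lemma cartanD M (F G : 'X_{1..n} -> M) a :
  cartan (fun b => F b + G b) a = cartan F a + cartan G a.
Proof. by rewrite -big_split; apply: eq_bigr => i _; rewrite linearD. Qed.

Lemma cartanN M (F : 'X_{1..n} -> M) a :
  cartan (fun b => - F b) a = - cartan F a.
Proof. by rewrite -sumrN; apply: eq_bigr => i _; rewrite linearN. Qed.

Lemma cartanB M (F G : 'X_{1..n} -> M) a :
  cartan (fun b => F b - G b) a = cartan F a - cartan G a.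
Proof. by rewrite cartanD cartanN. Qed.

Lemma cartan_map M N (f : 'Hom(M, N)) (F : 'X_{1..n} -> M) a :
    (forall b m, f (act M b m) = act N b (f m)) ->
  f (cartan F a) = cartan (fun b => f (F b)) a.
Proof. by move=> fact; rewrite linear_sum; apply: eq_bigr => i _ /=. Qed.

Lemma cartan_act M v (F : 'X_{1..n} -> M) a : v \in ext_gr 1 ->
  cartan (fun b => act M v (F b)) a = - act M v (cartan F a).
Proof.
move=> v1; rewrite linear_sum -sumrN; apply: eq_bigr => i _ /=.
by rewrite act_linform_anticomm ?evar_gr.
Qed.

(** The double sum is antisymmetric in its two indices. The diagonal is treated apart, since 2 may
    be zero in [K]. *)
Lemma cartan_cartan M (F : 'X_{1..n} -> M) a : cartan (cartan F) a = 0.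
Proof.
pose e i := act M (evar K i).
pose T i k := if (0 < a i)%N && (0 < (a - U_(i))%MM k)%N
  then e i (e k (F (a - U_(i) - U_(k))%MM)) else 0.
have -> : cartan (cartan F) a = \sum_(i < n) \sum_(k < n) T i k.
  rewrite /cartan big_mkcond; apply: eq_bigr => i _.
  rewrite /T; case: ifP => ai /=; last by rewrite big1.
  by rewrite linear_sum big_mkcond.
have Tii i : T i i = 0.
  by rewrite /T /e; case: ifP => // _; rewrite act_linform_sqr0 ?evar_gr.
have TC i k : T i k = - T k i.
  have [->|neik] := eqVneq i k; first by rewrite Tii oppr0.
  rewrite /T !mnmBE !mnm1E (negPf neik) eq_sym (negPf neik) !subn0 andbC.
  case: ifP => _; last by rewrite oppr0.
  rewrite /e act_linform_anticomm ?evar_gr // !submDA.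
  by rewrite [(U_(i) + _)%MM]addmC.
transitivity (\sum_(i < n) (\sum_(k < n | (k < i)%N) T i k
    + \sum_(k < n | (i < k)%N) T i k)).
  apply: eq_bigr => i _; rewrite (bigID (fun k : 'I_n => (k < i)%N)) /=.
  congr (_ + _); rewrite (bigD1 i) ?ltnn //= Tii add0r; apply: eq_bigl => k.
  by rewrite -leqNgt ltn_neqAle andbC -val_eqE eq_sym.
rewrite big_split /= (exchange_big_dep predT) //= -big_split big1 // => i _.
rewrite -big_split /=; under eq_bigr => k _ do rewrite (TC k i) addNr.
by rewrite big1.
Qed.

End Cartan.

(** Choice without an axiom: [xchoose] finds witnesses of boolean predicates, and [b0] is the
    witness outside [Q]. *)
Lemma fun_choice (A : Type) (B : choiceType) (b0 : B) (Q : pred A)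
    (P : A -> pred B) :
  (forall a, Q a -> exists b, P a b) -> exists f, forall a, Q a -> P a (f a).
Proof.
move=> exP; have exQP a : exists b, Q a ==> P a b.
  by case: (boolP (Q a)) => [/exP[b Pb]|_]; [exists b | exists b0].
by exists (fun a => xchoose (exQP a)) => a; apply/implyP/(xchooseP (exQP a)).
Qed.

(** * Exactness outside one degree: regular quotients and dimension shifting *)

Section Exactness.
Variables (K : fieldType) (n : nat).
Implicit Types M N : gmodule K n.

(* (M / U) (x) K[x_1, ..., x_n] is exact at (M / U)_j for all j <> c.         *)
Definition cartan_exact M (U : {vspace M}) (c : int) : Prop :=
  forall p j (F : 'X_{1..n} -> M), j != c -> (forall a, F a \in gr M j) ->
    (forall a, mdeg a = p.+1 -> cartan F a \in U) ->
  exists2 G : 'X_{1..n} -> M, forall a, G a \in gr M (j - 1) &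
    forall a, mdeg a = p -> F a - cartan G a \in U.

Lemma cartan_proj M (P : int -> 'End(M)) j (F : 'X_{1..n} -> M) a :
    graded_projections P ->
  P j (cartan F a) = cartan (fun b => P (j - 1) (F b)) a.
Proof.
move=> grP; rewrite linear_sum; apply: eq_bigr => i _ /=.
rewrite -{1}(subrK 1 j); apply: graded_projections_comm => // k x xk.
by rewrite addrC act_gr ?evar_gr.
Qed.

(** A preimage need not be homogeneous: its component of degree [j - 1] serves as well, because
    [cartan] raises the degree by one and [U] is homogeneous. *)
Lemma cartan_graded_lift M (U : {vspace M}) p j (F G : 'X_{1..n} -> M) :
    homogeneous_sub (gr M) U -> (forall a, F a \in gr M j) ->
    (forall a, mdeg a = p -> F a - cartan G a \in U) ->
  exists2 G' : 'X_{1..n} -> M, forall a, G' a \in gr M (j - 1) &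
    forall a, mdeg a = p -> F a - cartan G' a \in U.
Proof.
move=> homU Fj FG; have [P grP] := graded_projections_exist M.
have [PM PE _] := grP.
exists (fun b => P (j - 1) (G b)) => [a|a ap]; first exact: PM.
have := graded_projections_sub grP homU j (FG a ap).
by rewrite linearB /= (PE j j) // eqxx cartan_proj.
Qed.

Section RegularQuotient.
Variables (M : gmodule K n) (U : gsubmodule M) (c : int) (v : ext K n).
Hypotheses (v1 : v \in ext_gr 1) (exU : cartan_exact U c).
Hypothesis regU : forall x, act M v x \in (U : {vspace M}) ->
  exists y, x - act M v y \in (U : {vspace M}).

(** Write d for [cartan] and compute modulo [U]. As [v F] is a cycle of degree [j + 1], [v F = d G].
    Then [d (v G) = - v (d G) = 0], so by induction on [p], [G = v t1 + d t1']. Hence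
    [v (F + d t1) = 0], and regularity gives [F + d t1 = v t]. *)
Lemma cartan_regular_lift p j (F : 'X_{1..n} -> M) : j + 1 != c ->
    (forall a, F a \in gr M j) ->
    (forall a, mdeg a = p.+1 ->
       cartan (fun b => act M v (F b)) a \in (U : {vspace M})) ->
  exists t, exists t', forall a, mdeg a = p ->
    F a - act M v (t a) - cartan t' a \in (U : {vspace M}).
Proof.
move=> neq_jc.
have pick (H : 'X_{1..n} -> M) q :
    (forall a, mdeg a = q -> act M v (H a) \in (U : {vspace M})) ->
    exists t, forall a, mdeg a = q -> H a - act M v (t a) \in (U : {vspace M}).
  move=> vH; have [a|t tP] := @fun_choice 'X_{1..n} M 0
      (fun a => mdeg a == q) (fun a y => H a - act M v y \in (U : {vspace M})).
    by move/eqP/vH/regU=> [y yP]; exists y.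
  by exists t => a /eqP/tP.
elim: p F => [|p IH] F Fj dvF.
  have [a|G _ GP] := @exU _ _ _ neq_jc _ dvF.
    by rewrite addrC act_gr.
  (* There are no boundaries in polynomial degree 0, so [v F] itself lies in [U] there. *)
  have [a /= a0|t tP] := pick F 0%N.
    by have := GP a a0; rewrite cartan0 // subr0.
  exists t, (fun _ => 0) => a a0.
  by rewrite [cartan _ a]cartan0 // subr0 tP.
have [a|G Gj GP] := @exU _ _ _ neq_jc _ dvF.
  by rewrite addrC act_gr.
have [a|a ap|t1 [t1' tP]] := IH G.
- by have := Gj a; rewrite addrK.
- rewrite cartan_act // memvN.
  have := gsub_act v (GP a ap).
  by rewrite linearB /= act_linform_sqr0 // sub0r memvN.
have vD a : mdeg a = p.+1 ->
    act M v (F a + cartan t1 a) \in (U : {vspace M}).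
  move=> ap; have := cartan_sub (@gsub_act _ _ _ U) tP ap.
  rewrite !cartanB cartan_cartan subr0 cartan_act // opprK => dG.
  have := memvD (GP a ap) dG.
  by rewrite addrA subrK linearD.
have [t tP'] := pick _ _ vD.
exists t, (fun b => - t1 b) => a ap.
by rewrite cartanN opprK addrAC tP'.
Qed.

(** [U'] is [U + v M]. If [F] is a cycle modulo [U'], then [v F] is a cycle modulo [U], as [v] kills
    [v M]; in the resulting expression for [F] the term [v t] vanishes modulo [U']. *)
Lemma cartan_exact_regular (U' : gsubmodule M) :
    (forall x, x \in (U' : {vspace M}) <->
       exists y, x - act M v y \in (U : {vspace M})) ->
  cartan_exact U' (c - 1).
Proof.
move=> U'P p j F neq_jc Fj dF.
have [|//|a ap|t [t' tP]] := @cartan_regular_lift p j F.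
- by apply: contra neq_jc => /eqP <-; rewrite addrK.
- rewrite cartan_act // memvN; have /U'P[y yP] := dF a ap.
  by have := gsub_act v yP; rewrite linearB /= act_linform_sqr0 // subr0.
apply: (cartan_graded_lift (G := t')) => // [|a ap]; first exact: gsub_gr.
by apply/U'P; exists (t a); rewrite addrAC tP.
Qed.

End RegularQuotient.

Lemma homogeneous_lker M N (f : 'Hom(M, N)) :
  ghom f -> homogeneous_sub (gr M) (lker f).
Proof.
move=> [_ fgr] t y t_uniq yM; rewrite memv_ker linear_sum => /eqP sum0 i it.
have [_ indep] := gr_grading N.
rewrite memv_ker; apply/eqP; apply: (indep t (fun i => f (y i))) => // k.
by apply: (subvP (fgr k)); rewrite memv_img.
Qed.

(** Dimension shifting. Exactness of the kernels of all [d i] is proved by induction on the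
    polynomial degree [p]; passing from [I i] to [I i.+1] lowers both [j] and the exceptional degree
    by one. *)
Lemma cartan_exact_resolution M (I : nat -> gmodule K n)
    (eps : 'Hom(M, I 0%N)) (d : forall i, 'Hom(I i, I i.+1)) (c : int) :
    ghom eps -> (forall i, ghom (d i)) ->
    lker eps = 0%VS -> limg eps = lker (d 0%N) ->
    (forall i, limg (d i) = lker (d i.+1)) ->
    (forall i, cartan_exact (0%VS : {vspace I i}) (c - i%:Z)) ->
  cartan_exact (0%VS : {vspace M}) c.
Proof.
move=> eps_hom d_hom ker_eps im_eps im_d exI.
have exZ p : forall i j (F : 'X_{1..n} -> I i), j != c - i%:Z ->
    (forall a, F a \in gr (I i) j) -> (forall a, F a \in lker (d i)) ->
    (forall a, mdeg a = p.+1 -> cartan F a = 0) ->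
  exists2 G : 'X_{1..n} -> I i, forall a, G a \in lker (d i) &
    forall a, mdeg a = p -> F a = cartan G a.
  elim: p => [|p IH] i j F neq_jc Fj Fker dF.
    have [//|//|a ap|G _ GP] := @exI i 0%N j F; first by rewrite memv0 dF.
    exists (fun _ => 0) => [a|a a0]; first by rewrite mem0v.
    have := GP a a0; rewrite memv0 subr_eq0 => /eqP ->.
    by rewrite !cartan0.
  have [//|//|a ap|G Gj GP] := @exI i p.+1 j F; first by rewrite memv0 dF.
  have FG a : mdeg a = p.+1 -> F a = cartan G a.
    by move=> /GP; rewrite memv0 subr_eq0 => /eqP.
  have [d_act d_gr] := d_hom i.
  have [|a|a|a ap|g1 g1ker g1P] := IH i.+1 (j - 1) (fun a => d i (G a)).
  - apply: contra neq_jc; rewrite -addn1 PoszD opprD addrA.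
    by move=> /eqP/addIr->.
  - by apply: (subvP (d_gr _)); rewrite memv_img.
  - by rewrite -im_d memv_img ?memvf.
  - by rewrite -cartan_map // -FG //; apply/eqP; rewrite -memv_ker.
  (* [h] lifts [g1] along [d i]; subtracting [cartan h] moves [G] into the kernel without changing
     [cartan G]. *)
  pose h a := ((d i)^-1)%VF (g1 a).
  have dh a : d i (h a) = g1 a.
    by apply: limg_lfunVK; rewrite im_d.
  (* [G - cartan h] is known to lie in the kernel only in degree [p], hence the value 0
     elsewhere. *)
  exists (fun a => if mdeg a == p then G a - cartan h a else 0) => [a|a ap].
    rewrite memv_ker; have [ap|_] := eqVneq (mdeg a) p; last first.
      by rewrite linear0.
    rewrite linearB /= cartan_map // g1P //.
    rewrite subr_eq0; apply/eqP; apply: eq_bigr => k _ /=.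
    by rewrite dh.
  rewrite FG // -[LHS]subr0 -(cartan_cartan h a) -cartanB.
  by apply: eq_cartan => b; rewrite ap => -[->]; rewrite eqxx.
move=> p j F neq_jc Fj dF.
have [eps_act eps_gr] := eps_hom.
have [|a|a|a ap|G Gker GP] := exZ p 0%N j (fun a => eps (F a)).
- by rewrite subr0.
- by apply: (subvP (eps_gr _)); rewrite memv_img.
- by rewrite -im_eps memv_img ?memvf.
- rewrite -cartan_map //; have := dF a ap; rewrite memv0 => /eqP ->.
  by rewrite linear0.
pose G' a := (eps^-1)%VF (G a).
have GE a : eps (G' a) = G a by apply: limg_lfunVK; rewrite im_eps.
apply: (cartan_graded_lift (G := G')) => // [|a ap].
  by rewrite -ker_eps; apply: homogeneous_lker.
rewrite -ker_eps memv_ker linearB /= cartan_map // GP // subr_eq0.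
by apply/eqP; apply: eq_bigr => k _; rewrite GE.
Qed.

End Exactness.

(** * The Koszul complex of the exterior algebra *)
Section Koszul.
Variables (K : fieldType) (n : nat).
Implicit Types (A B : {set 'I_n}) (F : 'X_{1..n} -> ext K n).

Let sg (i : 'I_n) B : K := ext_sgn K [set i] B.

Lemma ext_coef_sum A (I : Type) (r : seq I) (P : pred I) (x : I -> ext K n) :
  coef A (\sum_(i <- r | P i) x i) = \sum_(i <- r | P i) coef A (x i).
Proof. exact: (raddf_sum (coef A : {linear ext K n -> K^o})). Qed.

Lemma ext_coefZ A k (x : ext K n) : coef A (k *: x) = k * coef A x.
Proof. exact: (linearZ_LR (coef A : {linear ext K n -> K^o})). Qed.

Lemma ext_coef0 A : coef A (0 : ext K n) = 0.
Proof. by rewrite /coef ffunE. Qed.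

Lemma coef_gr0 j A (x : ext K n) :
  x \in ext_gr j -> #|A|%:Z != j -> coef A x = 0.
Proof.
move=> xj neAj; move: x xj; apply: ext_gr_ind => [|k a b Pa Pb|T Tj].
- exact: ext_coef0.
- by rewrite coefZD Pa Pb mulr0 addr0.
by rewrite coef_mono; case: eqP => // eAT; rewrite eAT Tj eqxx in neAj.
Qed.

Lemma sgK i B : i \notin B -> sg i B * sg i B = 1.
Proof.
move=> iB; rewrite /sg /ext_sgn disjoints1 iB -exprD addnn -mul2n exprM.
by rewrite sqrrN expr1n expr1n.
Qed.

Lemma coef_evar_mul A i (x : ext K n) :
  coef A (evar K i * x)
    = if i \in A then sg i (A :\ i) * coef (A :\ i) x else 0.
Proof.
rewrite {1}[x]ext_sum_mono mulr_sumr ext_coef_sum.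
under eq_bigr => S _ do rewrite -scalerAr mono_mul scalerA ext_coefZ coef_mono.
case: ifP => iA.
  rewrite (bigD1 (A :\ i)) //= setD1K // eqxx mulr1 mulrC.
  rewrite big1 ?addr0 // => S neS; rewrite /ext_sgn disjoints1.
  case: ifP => iS; last by rewrite mulr0 mul0r.
  case: eqP => [eA|_]; last by rewrite mulr0.
  by rewrite eA setU1K ?eqxx in neS.
rewrite big1 // => S _; case: eqP => [eA|_]; last by rewrite mulr0.
by rewrite eA inE set11 in iA.
Qed.

(** Compare coefficients in [e_i e_k e_B = - e_k e_i e_B], then move signs across, each being its
    own inverse by [sgK]. *)
Lemma sg_swap i k B : i != k -> i \notin B -> k \notin B ->
  sg k (i |: B) * sg i (k |: B) = - (sg i B * sg k B).
Proof.
move=> neik iB kB.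
have nek : k \notin i |: B by rewrite !inE eq_sym (negPf neik).
have nei : i \notin k |: B by rewrite !inE (negPf neik).
have /(congr1 (coef (i |: (k |: B)))) :
    evar K i * (evar K k * mono K B) = - (evar K k * (evar K i * mono K B)).
  by rewrite !mulrA evar_anticomm // mulNr.
have iA : i \in i |: (k |: B) by rewrite setU11.
have kA : k \in i |: (k |: B) by rewrite setU1r ?setU11.
have eAi : (i |: (k |: B)) :\ i = k |: B by rewrite setU1K.
have eAk : (i |: (k |: B)) :\ k = i |: B by rewrite setUCA setU1K.
rewrite -scaleN1r ext_coefZ !coef_evar_mul iA kA eAi eAk !setU11 !setU1K //.
rewrite !coef_mono !eqxx !mulr1 mulN1r => e.
rewrite -[LHS]mulr1 -(sgK iB) mulrACA -[sg k _ * sg i B]opprK -e.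
by rewrite mulNr mulrACA (sgK nei) mul1r [sg k B * _]mulrC.
Qed.

(* On the part of Z^n-degree deg(x^a) - deg(e_A) the differential is          *)
(* multiplication by the sum of the e_i with i not in A or a_i > 0: this set  *)
(* depends on the degree only, and contracting with its first element e_k     *)
(* (and dividing by x_k) is a homotopy when it is not empty.                  *)
Definition koszul_homotopy F (a : 'X_{1..n}) : ext K n :=
  [ffun A : {set 'I_n} =>
    if [pick i | (i \notin A) || (0 < a i)%N] is Some k then
      if k \in A then 0 else sg k A * coef (k |: A) (F (a + U_(k))%MM)
    else 0 : K^o].

Lemma addmUBC (a : 'X_{1..n}) (i k : 'I_n) : (0 < a i)%N ->
  (a - U_(i) + U_(k) = a + U_(k) - U_(i))%MM.
Proof.
move=> ai; apply/mnmP=> l; rewrite !(mnmDE, mnmBE, mnm1E).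
by case: (eqVneq i l) => [<-|] /=; rewrite ?subn0 // addnBAC.
Qed.

Lemma cartan_coef (F : 'X_{1..n} -> @ext_mod K n) a A :
  coef A (cartan F a) = \sum_(i < n | (i \in A) && (0 < a i)%N)
    sg i (A :\ i) * coef (A :\ i) (F (a - U_(i))%MM).
Proof.
rewrite /cartan ext_coef_sum [RHS]big_mkcondl; apply: eq_bigr => i ai.
by rewrite lfunE /= lfunE /= coef_evar_mul.
Qed.

(** Compare the coefficients of [e_A], with [k] the picked index. If [k] is in [A], only the term
    [i = k] survives, and it gives [F]. Otherwise the cycle condition at [k |: A] and [a + U_(k)]
    expresses the coefficient of [F] through the homotopy terms. *)
Lemma koszul_homotopyE j p (F : 'X_{1..n} -> @ext_mod K n) a :
    j != n%:Z -> (forall b, F b \in ext_gr j) ->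
    (forall b, mdeg b = p.+1 -> cartan F b = 0) -> mdeg a = p ->
  F a = cartan (koszul_homotopy F : _ -> @ext_mod K n) a.
Proof.
move=> neq_jn Fj dF ap; apply: ext_eqP => A; rewrite cartan_coef.
(* Passing from [A] and [a] to [A :\ i] and [a - U_(i)] preserves the multidegree, hence the picked
   index. *)
have pickE i : i \in A -> (0 < a i)%N ->
    [pick l | (l \notin A :\ i) || (0 < (a - U_(i))%MM l)%N]
  = [pick l | (l \notin A) || (0 < a l)%N].
  move=> iA ai; apply: eq_pick => l; rewrite !inE mnmBE mnm1E.
  by case: (eqVneq l i) => [->|] /=; rewrite ?ai ?orbT ?subn0.
case pA: [pick l | (l \notin A) || (0 < a l)%N] pickE => [k|] pickE; last first.
  (* If nothing is picked, [A] is the full set and [a] is zero: the right side is an empty sum, and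
     the left side vanishes because [j] is not [n]. *)
  move: pA; case: pickP => // pA0 _.
  rewrite (coef_gr0 (Fj a)).
    by rewrite big1 // => i /andP[_ ai]; have := pA0 i; rewrite ai orbT.
  suff -> : A = setT by rewrite cardsT card_ord eq_sym.
  by apply/setP=> i; have := pA0 i; rewrite inE; case: (i \in A).
have kP : (k \notin A) || (0 < a k)%N by move: pA; case: pickP => // ? ? [<-].
have hE i : i \in A -> (0 < a i)%N ->
    coef (A :\ i) (koszul_homotopy F (a - U_(i))%MM) =
    if k \in A :\ i then 0 else
      sg k (A :\ i) * coef (k |: (A :\ i)) (F (a - U_(i) + U_(k))%MM).
  by move=> iA ai; rewrite /coef ffunE pickE.
have [kA|kA] := boolP (k \in A).
  have ak : (0 < a k)%N by rewrite kA in kP.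
  rewrite (bigD1 k) ?kA //= hE // setD11 big1 => [|i /andP[/andP[iA ai] neik]].
    rewrite mulrA sgK ?setD11 // mul1r setD1K // addr0 addmUBC // addmK //.
  by rewrite hE // !inE eq_sym neik kA mulr0.
have := congr1 (coef (k |: A)) (dF (a + U_(k))%MM _).
rewrite mdegD mdeg1 ap addn1 => /(_ erefl); rewrite cartan_coef.
rewrite (bigD1 k) ?setU11 /=; last by rewrite mnmDE mnm1E eqxx addn1.
rewrite setU1K // addmK ext_coef0 => /(congr1 (fun x => sg k A * x)).
rewrite mulrDr mulrA sgK // mul1r mulr0 => /eqP; rewrite addr_eq0 => /eqP ->.
rewrite mulr_sumr -sumrN; apply: eq_big => [i|i].
  rewrite !inE mnmDE mnm1E [k == i]eq_sym.
by case: (eqVneq i k) => [->|_] /=; rewrite ?(negPf kA) ?addn0 ?andbT ?andbF.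
move=> /andP[/andP[]]; rewrite !inE mnmDE mnm1E => iA' ai' neik.
move: iA' ai'; rewrite (negPf neik) eq_sym (negPf neik) addn0 /= => iA ai.
rewrite hE // !inE (negPf kA) andbF mulrA mulrA.
have -> : (k |: A) :\ i = k |: (A :\ i).
  apply/setP=> l; rewrite !inE; case: (eqVneq l k) => [->|] //.
  by rewrite eq_sym neik.
rewrite addmUBC // -mulNr; congr (_ * _).
have := @sg_swap i k (A :\ i) neik; rewrite !inE eqxx (negPf kA) andbF.
by rewrite setD1K // => -> //; rewrite opprK.
Qed.

Lemma homogeneous_sub0 (M : gmodule K n) : homogeneous_sub (gr M) 0%VS.
Proof.
move=> t y t_uniq yM; rewrite memv0 => /eqP sum0 i it.
by have [_ indep] := gr_grading M; rewrite (indep t y) ?mem0v.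
Qed.

Lemma cartan_exact_ext : cartan_exact (0%VS : {vspace @ext_mod K n}) n.
Proof.
move=> p j F neq_jn Fj dF.
have dF0 b : mdeg b = p.+1 -> cartan F b = 0.
  by move/dF; rewrite memv0 => /eqP.
apply: (@cartan_graded_lift _ _ (@ext_mod K n) _ p _ F (koszul_homotopy F))
  => // [|a ap].
  exact: homogeneous_sub0.
by rewrite memv0 subr_eq0 {1}(koszul_homotopyE neq_jn Fj dF0 ap).
Qed.

Lemma gpow_actE (M : gmodule K n) k b (x : gpow M k) l :
  (act (gpow M k) b x : {ffun _ -> _}) l = act M b ((x : {ffun _ -> _}) l).
Proof. by rewrite lfunE /= lfunE /= ffunE. Qed.

Lemma cartan_exact_gpow_shift k mu (c : int) : c = n%:Z - k ->
  cartan_exact (0%VS : {vspace gpow (shift (@ext_mod K n) k) mu}) c.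
Proof.
move=> -> p j F neq_j Fj dF.
set M := gpow _ _ in F Fj dF *.
have cartanE (G : 'X_{1..n} -> M) a l :
    (cartan G a : {ffun _ -> _}) l
    = cartan (fun b => (G b : {ffun _ -> _}) l : @ext_mod K n) a.
  rewrite /cartan sum_ffunE; apply: eq_bigr => i _.
  exact: gpow_actE.
have /fin_all_exists[g gP] (l : 'I_mu) :
    exists g : 'X_{1..n} -> @ext_mod K n,
      forall a, mdeg a = p -> (F a : {ffun _ -> _}) l = cartan g a.
  have [|a|a ap|g _ gP] := @cartan_exact_ext p (k + j)
    (fun b => (F b : {ffun _ -> _}) l).
  - by apply: contra neq_j => /eqP <-; rewrite addrC addKr.
  - by have /mem_pow_gr := Fj a; apply.
  - by have := dF a ap; rewrite !memv0 -cartanE => /eqP->; rewrite ffunE.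
  by exists g => a /gP; rewrite memv0 subr_eq0 => /eqP.
apply: (@cartan_graded_lift _ _ M _ p _ F
    (fun a => [ffun l => g l a] : M)) => // [|a ap].
  exact: homogeneous_sub0.
rewrite memv0 subr_eq0; apply/eqP/ffunP=> l; rewrite cartanE gP //.
by apply: eq_bigr => i _; rewrite ffunE.
Qed.

Lemma cartan_exact_giso (M N : gmodule K n) c :
  giso M N -> cartan_exact (0%VS : {vspace N}) c ->
  cartan_exact (0%VS : {vspace M}) c.
Proof.
move=> [f [g [[f_act f_gr] [g_act g_gr] fK gK]]] exN p j F neq_jc Fj dF.
have [//|a|a ap|G Gj GP] := exN p j (fun a => f (F a)).
- by apply: (subvP (f_gr _)); rewrite memv_img.
- rewrite -cartan_map //; have := dF a ap; rewrite !memv0 => /eqP->.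
  by rewrite linear0.
exists (fun a => g (G a)) => [a|a ap].
  by apply: (subvP (g_gr _)); rewrite memv_img.
rewrite -cartan_map // -[F a]fK -linearB /=.
by have := GP a ap; rewrite !memv0 => /eqP->; rewrite linear0.
Qed.

(** The shift by [n - c + i] moves the exceptional degree [n] of [E] to [c - i], which is what
    dimension shifting requires of [I i]. *)
Lemma linear_inj_resolution_exact (M : gmodule K n) :
  linear_inj_resolution M -> exists c, cartan_exact (0%VS : {vspace M}) c.
Proof.
move=> [I [eps [d [[[eps_hom d_hom] _ [ker_eps im_eps im_d] _] [c [mu muP]]]]]].
exists c; apply: (cartan_exact_resolution eps_hom d_hom) => // i.
apply: cartan_exact_giso (muP i) _; apply: cartan_exact_gpow_shift.
by rewrite !opprD addrA addrA subrr sub0r opprK.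
Qed.

End Koszul.

(** * Specialization at a generic point *)
Section GenericPoint.

Lemma infinite_uniq_seq (T : eqType) (k : nat) : infinite_type T ->
  exists2 s : seq T, uniq s & size s = k.
Proof.
move=> infT; elim: k => [|k [s s_uniq s_size]]; first by exists [::].
by have [x xs] := infT s; exists (x :: s); rewrite /= ?xs ?s_uniq ?s_size.
Qed.

Lemma infinite_poly_nonroot (K : idomainType) (p : {poly K}) :
  infinite_type K -> p != 0 -> exists x, p.[x] != 0.
Proof.
move=> /(infinite_uniq_seq (size p))[s s_uniq s_size] p0.
have [|/allPn[x _ px]] := boolP (all (root p) s); last by exists x.
by move=> /(max_poly_roots p0)/(_ s_uniq); rewrite s_size ltnn.
Qed.

Lemma digits_inj (B n : nat) (f g : 'I_n -> nat) :
    (forall i, f i < B)%N -> (forall i, g i < B)%N ->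
    (\sum_(i < n) f i * B ^ i = \sum_(i < n) g i * B ^ i)%N -> f =1 g.
Proof.
elim: n f g => [|n IH] f g fB gB; first by move=> _ [].
have red (h : 'I_n.+1 -> nat) : (\sum_(i < n.+1) h i * B ^ i
    = (\sum_(i < n) h (lift ord0 i) * B ^ i) * B + h ord0)%N.
  rewrite big_ord_recl expn0 muln1 addnC; congr (_ + _)%N.
  by rewrite big_distrl /=; apply: eq_bigr => i _; rewrite expnSr mulnA.
rewrite !red => e.
have B0 : (0 < B)%N by apply: leq_ltn_trans (fB ord0).
have e0 : f ord0 = g ord0.
  by have := congr1 (modn^~ B) e; rewrite !modnMDl !modn_small.
move: e; rewrite e0 => /addIn/eqP; rewrite eqn_pmul2r // => /eqP e i.
case: (unliftP ord0 i) => [k|] -> //.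
by apply: (IH (fun i => f (lift ord0 i)) (fun i => g (lift ord0 i))).
Qed.

(* Kronecker substitution: x_i is replaced by t ^ (B ^ i) with B larger than  *)
(* all the exponents.                                                         *)
Lemma infinite_mpoly_nonroot (K : idomainType) (n : nat) (p : {mpoly K[n]}) :
  infinite_type K -> p != 0 -> exists v : 'I_n -> K, p.@[v] != 0.
Proof.
move=> infK p0; pose B := msize p.
pose key (m : 'X_{1..n}) := (\sum_(i < n) m i * B ^ i)%N.
pose P : {poly K} := \sum_(m <- msupp p) p@_m *: 'X^(key m).
have expB m i : m \in msupp p -> (m i < B)%N.
  move=> /msize_mdeg_lt; apply: leq_ltn_trans.
  by rewrite mdegE (bigD1 i) //= leq_addr.
have P0 : P != 0.
  have [m mp] : exists m, m \in msupp p.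
    case: (msupp p) (msupp_eq0 p) => [|m s _]; first by rewrite (negPf p0).
    by exists m; rewrite mem_head.
  (* The exponents [key m] are distinct by uniqueness of base-[B] digits, so no coefficients of [p]
     are merged in [P]. *)
  apply/eqP => /(congr1 (fun q : {poly K} => q`_(key m))).
  rewrite coef0 coef_sum (bigD1_seq m) ?msupp_uniq //= big1_seq => [|m'].
    rewrite coefZ coefXn eqxx mulr1 addr0 => /eqP.
    by rewrite mcoeff_eq0 mp.
  move=> /andP[nem m'p]; rewrite coefZ coefXn; case: eqP => [e|]; last first.
    by rewrite mulr0.
  case/eqP: nem; apply/mnmP; apply: (@digits_inj B n) => // i; exact: expB.
have [t tP] := infinite_poly_nonroot infK P0.
exists (fun i => t ^+ (B ^ i)); apply: contraNneq tP; rewrite mevalE => p_t.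
rewrite /P horner_sum -[X in _ == X]p_t; apply/eqP/eq_bigr => m _.
rewrite hornerZ hornerXn; congr (_ * _); rewrite -prodrXr.
by apply: eq_bigr => i _; rewrite -exprM mulnC.
Qed.

(** [q] is a nonzero minor of maximal size; wherever [f q] is nonzero, the same minor bounds the
    rank from below. *)
Lemma rank_specialize (R : idomainType) (m k : nat) (B : 'M[R]_(m, k)) :
  exists2 q : R, q != 0 & forall (L : fieldType) (f : {rmorphism R -> L}),
    f q != 0 -> (\rank (map_mx (@tofrac R) B) <= \rank (map_mx f B))%N.
Proof.
set BF := map_mx _ B; pose r := \rank BF.
pose g := maxrankfun BF; pose B1 := (rowsub g BF)^T.
have B1r : \rank B1 = r by rewrite mxrank_tr eq_maxrowsub.
have B1full : row_full B1 by rewrite /row_full B1r.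
pose h := fullrankfun B1full.
pose q := \det (rowsub h (rowsub g B)^T).
have qE (L : fieldType) (f : {rmorphism R -> L}) :
    f q = \det (rowsub h (rowsub g (map_mx f B))^T).
  by rewrite -det_map_mx map_mxsub -map_trmx map_mxsub.
exists q => [|L f fq].
  rewrite -(tofrac_eq0 q) qE -unitfE -unitmxE; exact: fullrowsub_unit.
have : rowsub h (rowsub g (map_mx f B))^T \in unitmx.
  by rewrite unitmxE unitfE -qE.
rewrite -row_full_unit => /eqP rk; rewrite -[X in (X <= _)%N]rk.
apply: leq_trans (mxrankS (rowsub_sub _ _)) _; rewrite mxrank_tr.
exact: mxrankS (rowsub_sub _ _).
Qed.

Lemma fraction_numden (R : idomainType) (x : {fraction R}) :
  exists2 d : R, d != 0 & exists n, tofrac d * x = tofrac n.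
Proof.
elim/quotW: x => x; exists (\d_x)%R; first exact: denom_ratioP.
exists (\n_x)%R; unlock FracField.tofrac.
rewrite -[LHS]FracField.pi_mul; apply/eqmodP; rewrite /= FracField.equivfE.
rewrite /FracField.mulf !numden_Ratio ?mul1r ?oner_eq0 ?denom_ratioP //.
by rewrite mulr1.
Qed.

Lemma common_denominator (R : idomainType) (m : nat)
    (z : 'rV[{fraction R}]_m) :
  exists2 q : R, q != 0 &
    exists z' : 'rV[R]_m, tofrac q *: z = map_mx (@tofrac R) z'.
Proof.
have /fin_all_exists[d dP] (l : 'I_m) : exists d : R,
    d != 0 /\ exists n, tofrac d * z 0 l = tofrac n.
  by have [d] := fraction_numden (z 0 l); exists d.
have /fin_all_exists[u uP] (l : 'I_m) :
    exists u, tofrac (d l) * z 0 l = tofrac u.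
  by case: (dP l).
exists (\prod_l d l); first by apply/prodf_neq0 => l _; case: (dP l).
exists (\row_l ((\prod_(k | k != l) d k) * u l)); apply/rowP=> l.
by rewrite !mxE (bigD1 l) //= !rmorphM /= -uP mulrA [tofrac (d l) * _]mulrC.
Qed.

End GenericPoint.

Lemma mcoeff_mulX (R : comNzRingType) (n : nat) (p : {mpoly R[n]})
    (k a : 'X_{1..n}) :
  (p * 'X_[k])@_a = if (k <= a)%MM then p@_(a - k)%MM else 0.
Proof.
case: ifP => ka; first by rewrite -{1}(submK ka) addmC mcoeffMX.
rewrite {1}[p]mpolyE mulr_suml raddf_sum big1 // => m _ /=.
rewrite -scalerAl -mpolyXD mcoeffZ mcoeffX.
case: eqP => [e|]; last by rewrite mulr0.
by rewrite -e lem_addl in ka.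
Qed.

Lemma mcoeff_mulC (R : comNzRingType) (n : nat) (p : {mpoly R[n]}) c a :
  (p * mpolyC n c)@_a = p@_a * c.
Proof. by rewrite mulrC mcoeffCM mulrC. Qed.

Lemma lepm_U (n : nat) (i : 'I_n) (a : 'X_{1..n}) :
  (U_(i) <= a)%MM = (0 < a i)%N.
Proof.
apply/mnm_lepP/idP => [/(_ i)|ai j]; first by rewrite mnm1E eqxx.
by rewrite mnm1E; case: eqP => [<-|].
Qed.

(** * Rank of multiplication by a generic linear form *)

Section GenericRank.
Import VectorInternalTheory.
Variables (K : fieldType) (n : nat) (N : gmodule K n).
Let R := {mpoly K[n]}.
Let C : {rmorphism K -> R} := @mpolyC n K.
Let FR : {rmorphism R -> {fraction R}} := @tofrac R.
Let d := dim N.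
Local Notation rN := (@r2v K N : 'rV[K]_d -> N).

Let T (i : 'I_n) : 'M[K]_d := lin1_mx (v2r \o act N (evar K i) \o r2v).

Definition gr_mx j : 'M[K]_(\dim (gr N j), d) :=
  \matrix_l v2r (vbasis (gr N j))`_l.

Let D : 'M[R]_d := \sum_i 'X_i *: map_mx C (T i).

Lemma v2r_act i x : v2r (act N (evar K i) x) = v2r x *m T i.
Proof. by rewrite /T mul_rV_lin1 /= v2rK. Qed.

Lemma cartan_mx (y : 'rV[R]_d) a :
  v2r (cartan (fun b => rN (map_mx (mcoeff b) y) : N) a)
    = map_mx (mcoeff a) (y *m D).
Proof.
rewrite linear_sum /= big_mkcond /= mulmx_sumr; apply/rowP=> k.
rewrite summxE mxE summxE raddf_sum; apply: eq_bigr => i _ /=.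
rewrite -scalemxAr mxE mulrC mcoeff_mulX lepm_U.
case: ifP => ai; last by rewrite mxE.
rewrite v2r_act r2vK !mxE raddf_sum; apply: eq_bigr => l _ /=.
by rewrite !mxE mcoeff_mulC.
Qed.

Lemma r2v_gr_mx j (z : 'rV[K]_(\dim (gr N j))) :
  rN (z *m gr_mx j) = \sum_l z 0 l *: (vbasis (gr N j))`_l.
Proof.
rewrite mulmx_sum_row linear_sum /=; apply: eq_bigr => l _.
by rewrite linearZ /= rowK v2rK.
Qed.

Lemma r2v_gr_mx_mem j (z : 'rV[K]_(\dim (gr N j))) :
  rN (z *m gr_mx j) \in gr N j.
Proof.
rewrite r2v_gr_mx; apply: rpred_sum => l _; apply: memvZ.
by apply: vbasis_mem; rewrite mem_nth ?size_tuple.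
Qed.

Lemma gr_mx_mem j x : x \in gr N j -> exists z, v2r x = z *m gr_mx j.
Proof.
move=> /coord_vbasis xE.
exists (\row_l coord (vbasis (gr N j)) l x); apply: (can_inj r2vK).
rewrite v2rK r2v_gr_mx {1}xE; apply: eq_bigr => l _.
by rewrite mxE.
Qed.

Lemma gr_mx_free j : row_free (gr_mx j).
Proof.
rewrite -kermx_eq0; apply/eqP/row_matrixP=> k; rewrite row0.
set z := row k _; have : z *m gr_mx j = 0 by rewrite -row_mul mulmx_ker row0.
move/(congr1 rN); rewrite r2v_gr_mx linear0 => sum0; apply/rowP=> l.
have /freeP := basis_free (vbasisP (gr N j)).
by move=> /(_ (fun l => z 0 l)) -> //; rewrite !mxE.
Qed.

Lemma mxrank_le_dim (U : {vspace N}) m (X : 'M[K]_(m, d)) :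
  (forall l, rN (row l X) \in U) -> (\rank X <= \dim U)%N.
Proof.
move=> XU; rewrite /dimv; apply: mxrankS; apply/row_subP => l.
by have := XU l; rewrite memvE /subsetv /= genmxE r2vK.
Qed.

Definition linform_at (w : 'I_n -> K) : ext K n := \sum_i w i *: evar K i.

Lemma linform_at_gr w : linform_at w \in ext_gr 1.
Proof. by apply: rpred_sum => i _; rewrite memvZ ?evar_gr. Qed.

(** [D] is the matrix of [cartan] on row vectors; [A j] restricts its source to degree [j], with the
    target in coordinates of all of [N]. *)
Let A j : 'M[R]_(\dim (gr N j), d) := map_mx C (gr_mx j) *m D.

Lemma rank_at_le w j :
  (\rank (map_mx (meval w) (A j)) <= \dim (act N (linform_at w) @: gr N j))%N.
Proof.
apply: mxrank_le_dim => l; rewrite map_mxM /=.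
have -> : map_mx (meval w) (map_mx C (gr_mx j)) = gr_mx j.
  by apply/matrixP=> ? ?; rewrite !mxE mevalC.
have -> : map_mx (meval w) D = \sum_i w i *: T i.
  rewrite /D; apply/matrixP=> p q; rewrite mxE !summxE raddf_sum.
  by apply: eq_bigr => i _ /=; rewrite !mxE mevalM mevalXU mevalC.
rewrite row_mul rowK mulmx_sumr linear_sum /=.
rewrite (_ : \sum_i _ = act N (linform_at w) (vbasis (gr N j))`_l).
  by apply/memv_img/vbasis_mem; rewrite mem_nth ?size_tuple.
rewrite /linform_at linear_sum sum_lfunE; apply: eq_bigr => i _ /=.
by rewrite -scalemxAr -v2r_act linearZ /= v2rK linearZ scale_lfunE.
Qed.

Section Exact.
Variable c : int.
Hypothesis exN : cartan_exact (0%VS : {vspace N}) c.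

(** Preimages found in single polynomial degrees are glued: [cartan G] in degree [k] depends only on
    [G] in degree [k - 1]. *)
Lemma cartan_exact_below j (F : 'X_{1..n} -> N) k : j != c ->
    (forall a, F a \in gr N j) -> (forall a, cartan F a = 0) ->
  exists2 G : 'X_{1..n} -> N, forall a, G a \in gr N (j - 1) &
    forall a, (mdeg a < k)%N -> F a = cartan G a.
Proof.
move=> neq_jc Fj dF; elim: k => [|k [G Gj GP]].
  by exists (fun _ => 0) => // a; rewrite mem0v.
have [a _|H Hj HP] := @exN k j F neq_jc Fj; first by rewrite dF mem0v.
exists (fun a => if (mdeg a).+1 == k then H a else G a) => [a|a].
  by case: ifP.
rewrite ltnS leq_eqVlt => /orP[/eqP ak|ak].
  have := HP a ak; rewrite memv0 subr_eq0 => /eqP ->.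
  by apply: eq_cartan => b; rewrite ak => ->; rewrite eqxx.
rewrite GP //; apply: eq_cartan => b ->.
by case: eqP ak => // ->; rewrite ltnn.
Qed.

Lemma mpoly_exact j (z : 'rV[R]_(\dim (gr N j))) : j != c -> z *m A j = 0 ->
  exists u : 'rV[R]_(\dim (gr N (j - 1))),
    z *m map_mx C (gr_mx j) = u *m A (j - 1).
Proof.
move=> neq_jc zA.
pose F a : N := rN (map_mx (mcoeff a) (z *m map_mx C (gr_mx j))).
have FE a : F a = rN (map_mx (mcoeff a) z *m gr_mx j).
  congr rN; apply/rowP=> k; rewrite !mxE raddf_sum; apply: eq_bigr => l _ /=.
  by rewrite !mxE mcoeff_mulC.
have Fj a : F a \in gr N j by rewrite FE r2v_gr_mx_mem.
have dF a : cartan F a = 0.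
  apply: (can_inj v2rK); rewrite cartan_mx -mulmxA zA linear0.
  by apply/rowP=> k; rewrite !mxE mcoeff0.
pose k := (\max_l msize (z 0%R l))%N.
have F0 a : (k <= mdeg a)%N -> F a = 0.
  move=> ka; rewrite FE (_ : map_mx _ z = 0) ?mul0mx ?linear0 //.
  apply/rowP=> l; rewrite !mxE; apply/eqP; rewrite mcoeff_eq0.
  by apply: msize_mdeg_ge; apply: leq_trans ka; rewrite leq_bigmax.
have [G Gj GP] := cartan_exact_below k neq_jc Fj dF.
have /fun_choice : forall a, predT a ->
    exists u, v2r (G a) == u *m gr_mx (j - 1).
  by move=> a _; have [u ->] := gr_mx_mem (Gj a); exists u.
move=> /(_ 0)[g gP].
have gE a : v2r (G a) = g a *m gr_mx (j - 1) by apply/eqP/gP.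
(* Truncation turns [g] into polynomials. As [cartan] raises the polynomial degree by one, the bound
   [k.-1] suffices for the degrees below [k]; from [k] on, both sides are zero. *)
pose u : 'rV[R]_(\dim (gr N (j - 1))) :=
  \row_l \sum_(m : 'X_{1..n < k.-1}) g m 0 l *: 'X_[m].
have uE a : map_mx (mcoeff a) u = if (mdeg a < k.-1)%N then g a else 0.
  apply/rowP=> l; rewrite !mxE; case: ifP => ak.
    by rewrite (mcoeff_mpoly (fun m => g m 0 l)).
  rewrite mxE raddf_sum big1 // => m _ /=; rewrite mcoeffZ mcoeffX.
  by case: eqP => [e|]; [rewrite -e bmdeg in ak | rewrite mulr0].
exists u; rewrite /A mulmxA.
suff eq_a a : map_mx (mcoeff a) (z *m map_mx C (gr_mx j))
            = map_mx (mcoeff a) (u *m map_mx C (gr_mx (j - 1)) *m D).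
  apply/rowP=> l; apply/mpolyP=> a.
  by have /rowP/(_ l) := eq_a a; rewrite !mxE.
rewrite -cartan_mx; apply: (can_inj r2vK); rewrite -/(F a) v2rK.
pose G' b := if (mdeg b < k.-1)%N then G b else 0.
have G'E b : rN (map_mx (mcoeff b) (u *m map_mx C (gr_mx (j - 1)))) = G' b.
  have -> : map_mx (mcoeff b) (u *m map_mx C (gr_mx (j - 1)))
      = map_mx (mcoeff b) u *m gr_mx (j - 1).
    apply/rowP=> l; rewrite !mxE raddf_sum; apply: eq_bigr => i _ /=.
    by rewrite !mxE mcoeff_mulC.
  rewrite uE /G'; case: ifP => _; last by rewrite mul0mx linear0.
  by rewrite -gE v2rK.
transitivity (cartan G' a); last by apply: eq_cartan => b _; rewrite G'E.
have [ak|ka] := ltnP (mdeg a) k.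
  rewrite GP //; apply: eq_cartan => b ab.
  by rewrite /G' -ltnS prednK ?ab // (leq_ltn_trans _ ak).
rewrite F0 //; apply/esym/big1 => i ai.
rewrite /G'; case: (posnP k) => [->|k0]; first by rewrite ltn0 linear0.
by rewrite -ltnS mdeg_subU // prednK // ltnNge ka linear0.
Qed.

(** The nullity of [A j] is at most the rank of [A (j - 1)]: after clearing denominators,
    [mpoly_exact] puts each kernel vector into the row space of [A (j - 1)]. *)
Lemma generic_rank_ge j : j != c ->
  (\dim (gr N j) <= \rank (map_mx FR (A j)) + \rank (map_mx FR (A (j - 1))))%N.
Proof.
move=> neq_jc.
rewrite -leq_subLR -mxrank_ker.
have free_C : row_free (map_mx FR (map_mx C (gr_mx j))).
  by rewrite -map_mx_comp (row_free_map (FR \o C)) gr_mx_free.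
rewrite -(mxrankMfree _ free_C); apply: mxrankS; apply/row_subP=> l.
rewrite row_mul; set z := row l _.
have zA : z *m map_mx FR (A j) = 0 by rewrite -row_mul mulmx_ker row0.
have [q q0 [z' z'E]] := common_denominator z.
have z'A : z' *m A j = 0.
  have /matrixP e : map_mx FR (z' *m A j) = 0.
    by rewrite map_mxM -z'E -scalemxAl zA scaler0.
  apply/matrixP=> a b; have := e a b; rewrite !mxE => /eqP.
  by rewrite tofrac_eq0 => /eqP.
have [u uE] := mpoly_exact neq_jc z'A.
have q0' : tofrac q != 0 by rewrite tofrac_eq0.
rewrite -(eqmx_scale _ q0') scalemxAl z'E -map_mxM uE map_mxM.
exact: submxMl.
Qed.

(** The product of the minors for the finitely many degrees in [js] is a nonzero polynomial; any
    point where it does not vanish serves all these degrees at once. *)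
Lemma generic_linform (js : seq int) : infinite_type K -> exists w, forall j,
    j \in js -> j - 1 \in js -> j != c ->
  (\dim (gr N j) <= \dim (act N (linform_at w) @: gr N j)
                     + \dim (act N (linform_at w) @: gr N (j - 1)))%N.
Proof.
move=> infK.
have [q q0 qP] : exists2 q : R, q != 0 & forall w, q.@[w] != 0 ->
    forall j, j \in js ->
    (\rank (map_mx FR (A j)) <= \rank (map_mx (meval w) (A j)))%N.
  elim: js => [|j js [q q0 qP]]; first by exists 1; rewrite ?oner_eq0.
  have [r r0 rP] := rank_specialize (A j).
  exists (r * q) => [|w]; first by rewrite mulf_neq0.
  rewrite mevalM mulf_eq0 negb_or => /andP[rw qw] k.
  by rewrite inE => /orP[/eqP->|/(qP _ qw)//]; apply: rP.
have [w qw] := infinite_mpoly_nonroot infK q0.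
exists w => j j1 j2 neq_jc; apply: leq_trans (generic_rank_ge neq_jc) _.
by apply: leq_add; apply: leq_trans (qP w qw _ _) (rank_at_le w _).
Qed.

End Exact.
End GenericRank.

(** * Regular sequences and Hilbert series *)
Section RegularSequences.
Variables (K : fieldType) (n : nat) (M : gmodule K n).

Lemma mem_lin_sub_rcons s (v : linform K n) x :
  x \in (lin_sub M (rcons s v) : {vspace M}) <->
  exists y, x - act M (vsval v) y \in (lin_sub M s : {vspace M}).
Proof.
rewrite /= /lin_sub_vs big_rcons /= addvC; split.
  move=> /memv_addP[y /memv_imgP[z _ ->] [u us ->]].
  by exists z; rewrite addrC addKr.
move=> [y yP]; rewrite -(subrK (act M (vsval v) y) x) addrC memv_add //.
by rewrite memv_img ?memvf.
Qed.

(** Regularity on the quotient, restated inside [M] in the form that the lifting argument for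
    [cartan] uses. *)
Lemma regular_eltP (U : gsubmodule M) (v : linform K n) :
  regular_elt (quot U) v <->
  forall x, act M (vsval v) x \in (U : {vspace M}) ->
    exists y, x - act M (vsval v) y \in (U : {vspace M}).
Proof.
split=> [reg x vx|reg].
  have : quot_proj U x \in lker (act (quot U) (vsval v)).
    by rewrite memv_ker quot_actE quot_proj_eq0.
  rewrite reg => /memv_imgP[z _ zE]; exists (vsval z).
  by rewrite -quot_proj_eq0 linearB /= zE -quot_actE vsvalK_quot subrr.
apply/eqP; rewrite eqEsubv; apply/andP; split; apply/subvP=> z.
  rewrite memv_ker -(vsvalK_quot z) quot_actE quot_proj_eq0 => /reg[y].
  rewrite -quot_proj_eq0 linearB /= subr_eq0 -quot_actE => /eqP->.
  by rewrite memv_img ?memvf.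
by move=> /memv_imgP[y _ ->]; rewrite memv_ker act_linform_sqr0 ?subvsP.
Qed.

Lemma cartan_exact_quot (U : gsubmodule M) c :
  cartan_exact (U : {vspace M}) c ->
  cartan_exact (0%VS : {vspace quot U}) c.
Proof.
move=> exU p j F neq_jc Fj dF.
have /(fun_choice 0)[F' F'P] : forall a, predT a ->
    exists x, (x \in gr M j) && (F a == quot_proj U x).
  by move=> a _; have /memv_imgP[x xj ->] := Fj a; exists x; rewrite xj eqxx.
have FE a : F a = quot_proj U (F' a) by case/andP: (F'P a isT) => _ /eqP.
have proj_cartan H a : quot_proj U (cartan H a)
    = cartan (fun b => quot_proj U (H b) : quot U) a.
  apply: (@cartan_map _ _ M (quot U) (quot_proj U)) => b m.
  by rewrite quot_actE.
have [a|a ap|G Gj GP] := exU p j F' neq_jc.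
- by case/andP: (F'P a isT).
- rewrite -quot_proj_eq0 proj_cartan -memv0.
  rewrite (_ : cartan _ a = cartan F a) ?dF //.
  by apply: eq_cartan => b _; rewrite FE.
exists (fun a => quot_proj U (G a)) => [a|a ap]; first exact: memv_img.
by rewrite -proj_cartan FE -linearB /= memv0 quot_proj_eq0 GP.
Qed.

Lemma cartan_exact_regular_seq vs c : regular_seq M vs ->
  cartan_exact (0%VS : {vspace M}) c ->
  cartan_exact (lin_sub M vs : {vspace M}) (c - (size vs)%:Z).
Proof.
move=> [reg _] ex0.
suff ex i : (i <= size vs)%N ->
    cartan_exact (lin_sub M (take i vs) : {vspace M}) (c - i%:Z).
  by have := ex _ (leqnn _); rewrite take_size.
elim: i => [|i IH] i_vs.
  by rewrite take0 /= /lin_sub_vs big_nil subr0.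
rewrite -addn1 PoszD opprD addrA addn1.
apply: (cartan_exact_regular (v := vsval vs`_i) _ (IH (ltnW i_vs))).
- exact: subvsP.
- exact/regular_eltP/reg.
by move=> x; rewrite (take_nth 0) //; apply: mem_lin_sub_rcons.
Qed.

Lemma lker_quot_proj (U : gsubmodule M) : lker (quot_proj U) = U.
Proof. by apply/vspaceP=> x; rewrite memv_ker quot_proj_eq0. Qed.

Lemma dim_gr_quot (U : gsubmodule M) j :
  (\dim (gr M j :&: U) + \dim (gr (quot U) j) = \dim (gr M j))%N.
Proof. by rewrite -{1}(lker_quot_proj U) limg_ker_dim. Qed.

(** With [U' = U + v M], regularity makes multiplication by [v] an isomorphism from [M / U'] in
    degree [j - 1] onto [U' / U] in degree [j]. The rest is rank-nullity. *)
Lemma dim_gr_regular (U : gsubmodule M) s (v : linform K n) j :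
    U = lin_sub M s -> regular_elt (quot U) v ->
  (\dim (gr (quot U) j) = \dim (gr (quot (lin_sub M (rcons s v))) j)
     + \dim (gr (quot (lin_sub M (rcons s v))) (j - 1)))%N.
Proof.
move=> eqU /regular_eltP reg; set U' := lin_sub M (rcons s v).
set e := act M (vsval v).
have U'P x : x \in (U' : {vspace M}) <-> exists y, x - e y \in (U : {vspace M}).
  by rewrite eqU; apply: mem_lin_sub_rcons.
have eU' x : (e x \in (U : {vspace M})) = (x \in (U' : {vspace M})).
  apply/idP/idP => [/reg/U'P//|/U'P[y yP]].
  have := gsub_act (vsval v) yP.
  by rewrite linearB /= act_linform_sqr0 ?subvsP // subr0.
have U_U' : (U <= U')%VS.
  by apply/subvP=> x xU; apply/U'P; exists 0; rewrite linear0 subr0.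
have eq_img : ((quot_proj U \o e) @: gr M (j - 1)
    = quot_proj U @: (gr M j :&: U'))%VS.
  apply/eqP; rewrite eqEsubv; apply/andP; split; apply/subvP=> z.
    move=> /memv_imgP[x xj ->]; rewrite comp_lfunE memv_img // memv_cap.
    have := act_gr (subvsP v) xj; rewrite addrC subrK => -> /=.
    by apply/U'P; exists x; rewrite subrr mem0v.
  move=> /memv_imgP[m]; rewrite memv_cap => /andP[mj /U'P[y yP]] ->.
  (* The witness [y] need not be homogeneous; it is replaced by its component of degree [j - 1]. *)
  have [P grP] := graded_projections_exist M; have [PM PE _] := grP.
  have ePC : P j (e y) = e (P (j - 1) y).
    rewrite -{1}(subrK 1 j); apply: graded_projections_comm => // i x xi.
    by rewrite addrC act_gr ?subvsP.
  have := graded_projections_sub grP (gsub_gr (g := U)) j yP.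
  rewrite linearB /= (PE j j) // eqxx ePC => /quot_projP ->.
  by rewrite -comp_lfunE memv_img.
have ker_img :
    (gr M (j - 1) :&: lker (quot_proj U \o e) = gr M (j - 1) :&: U')%VS.
  apply/vspaceP=> x; rewrite !memv_cap; congr (_ && _).
  by rewrite memv_ker comp_lfunE quot_proj_eq0 eU'.
have := limg_ker_dim (quot_proj U \o e) (gr M (j - 1)).
rewrite ker_img eq_img.
have := limg_ker_dim (quot_proj U) (gr M j :&: U').
rewrite lker_quot_proj -capvA (capv_idPr U_U').
have := dim_gr_quot U j; have := dim_gr_quot U' j.
have := dim_gr_quot U' (j - 1).
move=> d1 d2 d3 d4 d5; apply: (@addnI (\dim (gr M j :&: U))).
rewrite d3 -d2 -d4 -[LHS]addnA; congr (_ + _)%N; rewrite addnC; congr (_ + _)%N.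
by apply: (@addnI (\dim (gr M (j - 1) :&: U'))); rewrite d5.
Qed.

End RegularSequences.

(** * Euler characteristic of the complex given by a linear form *)

Section EulerCharacteristic.
Variables (K : fieldType) (n : nat) (N : gmodule K n) (v : ext K n).
Hypothesis v1 : v \in ext_gr 1.
Hypothesis N_bounded : forall j : int, ~~ (0 <= j <= n%:Z) -> gr N j = 0%VS.

Let h j := \dim (gr N j).
Let r j := \dim (act N v @: gr N j).

Lemma img_act_sub j : (act N v @: gr N (j - 1) <= gr N j :&: lker (act N v))%VS.
Proof.
apply/subvP=> x /memv_imgP[y yj ->]; rewrite memv_cap memv_ker.
rewrite act_linform_sqr0 // eqxx andbT.
by have := act_gr v1 yj; rewrite addrC subrK.
Qed.

Lemma rank_act_le j : (r j + r (j - 1) <= h j)%N.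
Proof.
by rewrite /h -(limg_ker_dim (act N v)) addnC leq_add2r dimvS ?img_act_sub.
Qed.

(** By rank-nullity the bound turns the inclusion [img_act_sub] into an equality in each degree; the
    projections reduce the claim to homogeneous elements. *)
Lemma regular_of_ranks : (forall j, h j <= r j + r (j - 1))%N ->
  lker (act N v) = limg (act N v).
Proof.
move=> h_le.
have cyc j : (gr N j :&: lker (act N v) = act N v @: gr N (j - 1))%VS.
  apply/esym/eqP; rewrite eqEdim img_act_sub /=.
  by rewrite -(leq_add2r (r j)) limg_ker_dim addnC h_le.
have [P grP] := graded_projections_exist N; have [PM PE [t _ sumP]] := grP.
apply/eqP; rewrite eqEsubv; apply/andP; split; apply/subvP=> x.
  rewrite memv_ker => /eqP vx; rewrite [x]sumP; apply: rpred_sum => i _.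
  suff : P i x \in (gr N i :&: lker (act N v))%VS.
    by rewrite cyc; apply: subvP; apply: limgS; apply: subvf.
  rewrite memv_cap PM memv_ker.
  rewrite -(@graded_projections_comm _ _ _ _ _ _ _ 1 grP grP) ?vx.
    by rewrite linear0 eqxx.
  by move=> k y yk; rewrite addrC act_gr.
by move=> /memv_imgP[y _ ->]; rewrite memv_ker act_linform_sqr0.
Qed.

(* The sum of h_j - r_j - r_(j-1) with alternating signs telescopes to the    *)
(* alternating sum of the h_j, and only its term of index c can be nonzero.   *)
Lemma regular_of_euler (c : int) :
    (forall j, j != c -> h j <= r j + r (j - 1))%N ->
    \sum_(k < n.+1) (-1) ^+ k * (h k%:Z)%:Z = 0 ->
  lker (act N v) = limg (act N v).
Proof.
move=> h_le euler; apply: regular_of_ranks => j.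
have [ejc|] := eqVneq j c; last exact: h_le.
have [/andP[]|/N_bounded j_out] := boolP (0 <= j <= n%:Z); last first.
  by rewrite /h j_out dimv0.
case: j ejc => // k ejc _; rewrite lez_nat -ltnS => kn.
pose delta (i : nat) : int := (h i)%:Z - (r i + r (i%:Z - 1))%N%:Z.
(* Each [r i] occurs in two consecutive terms with opposite signs; only the two ends remain. *)
have tel m : \sum_(i < m) (-1) ^+ i * (r i%:Z + r (i%:Z - 1))%N%:Z
    = (r (-1))%:Z - (-1) ^+ m * (r (m%:Z - 1))%:Z :> int.
  elim: m => [|m IH]; first by rewrite big_ord0 mul1r sub0r subrr.
  rewrite big_ord_recr /= IH PoszD mulrDr addrA addrAC addrNK exprS.
  by rewrite mulN1r mulNr opprK -addn1 PoszD addrK.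
(* Both ends, [r (-1)] and [r n], vanish: the source of the first and the target of the second lie
   outside the degrees from 0 to [n]. *)
have r_out i : ~~ (0 <= i + 1 <= n%:Z) || ~~ (0 <= i <= n%:Z) -> r i = 0%N.
  case/orP=> /N_bounded out; last by rewrite /r out limg0 dimv0.
  apply/eqP; rewrite /r dimv_eq0 -subv0; apply/subvP=> x /memv_imgP[y yi ->].
  by rewrite -out addrC act_gr.
have sum0 : \sum_(i < n.+1) (-1) ^+ i * delta i = 0.
  rewrite /delta; under eq_bigr => i _ do rewrite mulrBr.
  rewrite sumrB euler tel r_out ?r_out ?mulr0 ?subrr //.
  by rewrite subrK !lez_nat ltnn andbF.
have : (-1) ^+ k * delta k = 0.
  rewrite -sum0 (bigD1 (Ordinal kn)) //= big1 ?addr0 // => i neik.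
  have nec : i%:Z != c.
    by rewrite -ejc; apply: contra neik => /eqP[e]; apply/eqP/val_inj.
  have /eqP-> : delta i == 0; last by rewrite mulr0.
  rewrite /delta subr_eq0 eqz_nat eqn_leq h_le //=; exact: rank_act_le.
move/eqP; rewrite mulf_eq0 signr_eq0 /= /delta subr_eq0 eqz_nat => /eqP->.
exact: leqnn.
Qed.

End EulerCharacteristic.

(** * The Hilbert polynomial of a maximal regular quotient *)

Section MainProof.
Variables (K : fieldType) (n : nat).

Lemma ext_gr_out (j : int) : ~~ (0 <= j <= n%:Z) -> @ext_gr K n j = 0%VS.
Proof.
move=> j_out; apply/eqP; rewrite -subv0; apply/subvP.
apply: ext_gr_ind => [|k a b|S Sj]; first exact: mem0v.
  by rewrite !memv0 => /eqP-> /eqP->; rewrite scaler0 addr0.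
case/negP: j_out; rewrite -Sj /= lez_nat.
by rewrite (leq_trans (max_card _)) ?card_ord.
Qed.

Lemma quot_gr_out (M : gmodule K n) (U : gsubmodule M) j :
  gr M j = 0%VS -> gr (quot U) j = 0%VS.
Proof. by move=> /= Mj; rewrite /quot_gr Mj limg0. Qed.

Section Bounded.
Variable M : gmodule K n.
Hypothesis M_bounded : forall j : int, ~~ (0 <= j <= n%:Z) -> gr M j = 0%VS.

(** The Hilbert series of [M / (s) M], a polynomial because [M] lives in degrees 0 to [n]. *)
Definition quot_poly (s : seq (linform K n)) : {poly int} :=
  \poly_(k < n.+1) (\dim (gr (quot (lin_sub M s)) k%:Z))%:Z.

Lemma coef_quot_poly s k :
  (quot_poly s)`_k = (\dim (gr (quot (lin_sub M s)) k%:Z))%:Z.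
Proof.
rewrite coef_poly; case: ltnP => // nk.
by rewrite quot_gr_out ?dimv0 // M_bounded //= lez_nat -ltnNge.
Qed.

Lemma quot_poly_rcons s v : regular_elt (quot (lin_sub M s)) v ->
  quot_poly s = quot_poly (rcons s v) * (1 + 'X).
Proof.
move=> reg; apply/polyP=> k; rewrite mulrDr mulr1 coefD coefMX !coef_quot_poly.
rewrite (dim_gr_regular _ (erefl (lin_sub M s)) reg) PoszD; congr (_ + _).
case: k => [|k]; last by rewrite /= -addn1 PoszD addrK.
by rewrite quot_gr_out ?dimv0 // M_bounded.
Qed.

Lemma quot_poly_nil vs : regular_seq M vs ->
  quot_poly [::] = quot_poly vs * (1 + 'X) ^+ size vs.
Proof.
move=> [reg _]; suff H i : (i <= size vs)%N ->
    quot_poly [::] = quot_poly (take i vs) * (1 + 'X) ^+ i.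
  by have := H _ (leqnn _); rewrite take_size.
elim: i => [|i IH] i_vs; first by rewrite take0 mulr1.
rewrite (IH (ltnW i_vs)) (take_nth 0 i_vs) exprS mulrA; congr (_ * _).
by apply: quot_poly_rcons; apply: reg.
Qed.

Lemma hilbert_series_quot_poly i :
  hilbert_series M i = laurent_of_poly (quot_poly [::]) i.
Proof.
rewrite /hilbert_series /laurent_of_poly; case: i => k; last first.
  by rewrite M_bounded ?dimv0.
have cap0 : (gr M k :&: lin_sub M [::] = 0)%VS.
  by rewrite /= /lin_sub_vs big_nil capv0.
by rewrite coef_quot_poly -(dim_gr_quot (lin_sub M [::])) cap0 dimv0.
Qed.

(** If the value at -1 were zero, the Euler characteristic would make a generic linear form regular
    on [N], and it would prolong [vs]. *)
Lemma quot_poly_at_N1 vs c : infinite_type K -> maximal_regular_seq M vs ->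
  cartan_exact (0%VS : {vspace M}) c -> (quot_poly vs).[-1] != 0.
Proof.
move=> infK [reg_vs max_vs] exM; apply/eqP => euler.
pose N := quot (lin_sub M vs).
have N_bounded j : ~~ (0 <= j <= n%:Z) -> gr N j = 0%VS.
  by move=> /M_bounded/quot_gr_out; apply.
have exN := cartan_exact_quot (cartan_exact_regular_seq reg_vs exM).
(* The degrees from -1 to [n], so that [j] and [j - 1] are both listed when [j] is between 0 and
   [n]. *)
pose js : seq int := [seq k%:Z - 1 | k <- iota 0 n.+2].
have [w wP] := generic_linform exN js infK.
have js_mem j : 0 <= j <= n%:Z -> j \in js /\ j - 1 \in js.
  case: j => // k; rewrite /= lez_nat => kn; split; apply/mapP.
    by exists k.+1; rewrite ?mem_iota ?ltnS // -addn1 PoszD addrK.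
  by exists k; rewrite // mem_iota ltnS leqW.
have reg_w : lker (act N (linform_at w)) = limg (act N (linform_at w)).
  apply: (regular_of_euler (linform_at_gr w) N_bounded
    (c := c - (size vs)%:Z)) => [j nec|].
    have [/js_mem[j1 j2]|/N_bounded->] := boolP (0 <= j <= n%:Z).
      exact: wP.
    by rewrite dimv0.
  rewrite -[RHS]euler horner_poly; apply: eq_bigr => i _; exact: mulrC.
pose v : linform K n := vsproj (ext_gr 1) (linform_at w).
have vE : vsval v = linform_at w by rewrite vsprojK ?linform_at_gr.
have reg_v : regular_elt N v by rewrite /regular_elt vE.
apply: (max_vs v); split=> [i|].
  rewrite size_rcons ltnS leq_eqVlt => /orP[/eqP->|i_vs].
    by rewrite -cats1 take_size_cat // nth_cat ltnn subnn.
  rewrite -cats1 take_cat i_vs nth_cat i_vs.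
  by have [reg _] := reg_vs; apply: reg.
have quot0 (U : gsubmodule M) : {:quot U}%VS = 0%VS <->
    forall x : M, x \in (U : {vspace M}).
  split=> [q0 x|allU].
    by rewrite -quot_proj_eq0 -memv0 -[0%VS]q0 memvf.
  apply/eqP; rewrite -subv0; apply/subvP=> z _.
  by rewrite memv0 -(vsvalK_quot z) quot_proj_eq0.
(* The longer sequence still has a nonzero quotient: if [U + v M = M], then [v M] lies in [U]
   because [v] squares to zero, hence [U = M]. *)
have [_ /eqP nz] := reg_vs; apply/eqP=> /quot0 allU'; apply/nz/quot0 => x.
have eU y : act M (vsval v) y \in (lin_sub M vs : {vspace M}).
  have /mem_lin_sub_rcons[z zP] := allU' y.
  have := gsub_act (vsval v) zP.
  by rewrite linearB /= act_linform_sqr0 ?subvsP // subr0.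
have /mem_lin_sub_rcons[z zP] := allU' x.
by rewrite -(subrK (act M (vsval v) z) x) memvD.
Qed.

End Bounded.

End MainProof.

Theorem theorem4p1 (K : fieldType) (n s : nat) (J : graded_ideal K n)
  (K_infinite : infinite_type K)
  (J_neq0 : (J : {vspace ext K n}) != 0%VS)
  (J_proper : (J : {vspace ext K n}) != fullv)
  (depth_s : has_depth (ext_quot J) s)
  (linear_inj : linear_inj_resolution (ext_quot J)) :
  exists Q : {poly int},
    [/\ forall i : nat, 0 <= Q`_i,
        forall i : int, hilbert_series (ext_quot J) i
                      = laurent_of_poly (Q * (1 + 'X) ^+ s) i
      & Q.[-1] != 0].
Proof.
have bounded j : ~~ (0 <= j <= n%:Z) -> gr (ext_quot J) j = 0%VS.
  by move=> /ext_gr_out j_out; apply: quot_gr_out.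
have [vs max_vs <-] := depth_s; have [reg_vs _] := max_vs.
have [c exM] := linear_inj_resolution_exact linear_inj.
exists (quot_poly (ext_quot J) vs); split=> [i|i|].
- by rewrite coef_quot_poly.
- by rewrite hilbert_series_quot_poly // (quot_poly_nil bounded reg_vs).
exact: quot_poly_at_N1 exM.
Qed.
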